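(* The basis $B^*$ of $O_q(M(n))$ is invariant under multiplication by $\det_q$. More precisely, $$b(A)\,{\det}_q=b(A+I_n)$$ for all $A\in M_n(\mathbb{Z}_+)$, where $I_n$ is the $n\times n$ identity matrix.
   Context: Let $K=\mathbb{Q}(q)$ and $\mathbb{Z}_+=\{0,1,2,\dots\}$. $O_q(M(n))$ is the associative $K$-algebra generated by $Z_{ij}$ ($1\le i,j\le n$) with relations $Z_{ij}Z_{ik}=q^2Z_{ik}Z_{ij}$ if $j<k$; $Z_{ij}Z_{kj}=q^2Z_{kj}Z_{ij}$ if $i<k$; $Z_{ij}Z_{st}=Z_{st}Z_{ij}$ if $i>s,\ j<t$; $Z_{ij}Z_{st}=Z_{st}Z_{ij}+(q^2-q^{-2})Z_{it}Z_{sj}$ if $i<s,\ j<t$. The bar map is the anti-automorphism of $O_q(M(n))$ as a $\mathbb{Q}$-algebra with $Z_{ij}\mapsto Z_{ij}$, $q\mapsto q^{-1}$. The quantum determinant is $\det_q=\sum_{\sigma\in S_n}(-q^2)^{l(\sigma)}Z_{1\sigma(1)}\cdots Z_{n\sigma(n)}$. For $A=(a_{ij})\in M_n(\mathbb{Z}_+)$ let $Z^A=\prod_{i,j}Z_{ij}^{a_{ij}}$ with factors in lexicographic order of $(i,j)$; $D(A)=q^{-\sum_i\sum_{j>k}a_{ij}a_{ik}-\sum_i\sum_{j>k}a_{ji}a_{ki}}$, $Z(A)=D(A)Z^A$, $L^*=\bigoplus_A\mathbb{Z}[q]Z(A)$. $ro(A)$, $co(A)$ are the vectors of row sums and column sums.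 $B<A$ means that, reading entries in lexicographic order of positions, the first differing entry is smaller in $B$. $B^*=\{b(A)\mid A\in M_n(\mathbb{Z}_+)\}$ is the unique basis of $L^*$ such that $\overline{b(A)}=b(A)$ and $b(A)=Z(A)+\sum_{B<A}h_B(A)Z(B)$ with $h_B(A)\in q\mathbb{Z}[q]$, $ro(B)=ro(A)$, $co(B)=co(A)$. *)

(* Defs.v *)
From HB Require Import structures.
From mathcomp Require Import all_boot all_order all_fingroup all_algebra.
From mathcomp Require Import generic_quotient ring_quotient fraction.
From mathcomp Require Import finmap monalg boolp.

Set Implicit Arguments.
Unset Strict Implicit.
Unset Printing Implicit Defensive.

Import GRing.Theory.
Local Open Scope ring_scope.
Local Open Scope quotient_scope.

Local Notation tofrac := (@FracField.tofrac _).

Section FracLift.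
Context (R : idomainType) (F : fieldType) (f : {rmorphism R -> F}).

(* The extension of an injective morphism f to the field of fractions. *)
Definition frac_lift (x : {fraction R}) : F :=
  f (frac (repr x)).1 / f (frac (repr x)).2.

Lemma frac_reprE (x : {fraction R}) :
  x * tofrac (frac (repr x)).2 = tofrac (frac (repr x)).1.
Proof.
rewrite -{1}[x]reprK; move: (repr x) => r; unlock FracField.tofrac.
rewrite -[LHS]FracField.pi_mul; apply/eqmodP => /=.
rewrite FracField.equivfE /FracField.mulf /=.
rewrite !numden_Ratio ?mulr1 ?mul1r ?oner_neq0 ?mulf_neq0 ?denom_ratioP //.
by rewrite mulrC.
Qed.

Lemma fracP (x : {fraction R}) : exists a b, b != 0 /\ x = tofrac a / tofrac b.
Proof.
exists (frac (repr x)).1, (frac (repr x)).2.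
have d0 : (frac (repr x)).2 != 0 := denom_ratioP (repr x).
by rewrite -frac_reprE mulfK ?tofrac_eq0.
Qed.

Context (f_eq0 : forall x, (f x == 0) = (x == 0)).

Lemma frac_liftE a b : b != 0 -> frac_lift (tofrac a / tofrac b) = f a / f b.
Proof.
move=> b0; rewrite /frac_lift; set x := tofrac a / _.
have d0 : (frac (repr x)).2 != 0 := denom_ratioP (repr x).
have := frac_reprE x; move: (frac (repr x)).1 (frac (repr x)).2 d0 => c d d0 xE.
have {xE} e : a * d = c * b.
  apply/eqP; rewrite -tofrac_eq !tofracM -xE mulrAC divfK //.
  by rewrite tofrac_eq0.
by apply/eqP; rewrite eqr_div ?f_eq0 // -!rmorphM e.
Qed.

Lemma frac_lift_tofrac a : frac_lift (tofrac a) = f a.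
Proof. by have := frac_liftE a (oner_neq0 R); rewrite !rmorph1 !divr1. Qed.

Lemma frac_lift_is_zmod_morphism : zmod_morphism frac_lift.
Proof.
move=> x y; have [a [b [b0 ->]]] := fracP x; have [c [d [d0 ->]]] := fracP y.
rewrite -mulNr -tofracN addf_div ?tofrac_eq0 // -!tofracM -tofracD.
rewrite !frac_liftE ?mulf_neq0 // -mulNr -rmorphN addf_div ?f_eq0 //.
by rewrite rmorphD !rmorphM.
Qed.

Lemma frac_lift_is_monoid_morphism : monoid_morphism frac_lift.
Proof.
split=> [|x y]; first by rewrite -tofrac1 frac_lift_tofrac rmorph1.
have [a [b [b0 ->]]] := fracP x; have [c [d [d0 ->]]] := fracP y.
rewrite mulf_div -!tofracM !frac_liftE ?mulf_neq0 //.
by rewrite mulf_div !rmorphM.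
Qed.

End FracLift.

Section EvalInverse.
Context (k F : fieldType) (f : {rmorphism {poly k} -> F}).
Context (f_eq0 : forall p, (f p == 0) = (p == 0)).

(* p |-> p(x^-1), where x is the image of the variable under f. *)
Definition eval_inv (p : {poly k}) : F := (map_poly (f \o polyC) p).[(f 'X)^-1].

Lemma eval_inv_is_zmod_morphism : zmod_morphism eval_inv.
Proof. by move=> p r; rewrite /eval_inv rmorphB hornerD hornerN. Qed.

Lemma eval_inv_is_monoid_morphism : monoid_morphism eval_inv.
Proof.
by split=> [|p r]; rewrite /eval_inv ?rmorph1 ?hornerC // rmorphM hornerM.
Qed.

HB.instance Definition _ :=
  GRing.isZmodMorphism.Build {poly k} F eval_inv eval_inv_is_zmod_morphism.
HB.instance Definition _ := GRing.isMonoidMorphism.Build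
  {poly k} F eval_inv eval_inv_is_monoid_morphism.

Lemma eval_inv_rev p : p != 0 ->
  eval_inv p * f 'X ^+ (size p).-1
    = f (\poly_(i < size p) p`_((size p).-1 - i)).
Proof.
move=> p0; have sp : (0 < size p)%N by rewrite size_poly_gt0.
have X0 : f 'X != 0 by rewrite f_eq0 polyX_eq0.
have -> : eval_inv p = \sum_(i < size p) f (p`_i)%:P * (f 'X)^-1 ^+ i.
  rewrite /eval_inv (@horner_coef_wide _ (size p)); last exact: size_poly.
  by apply: eq_bigr => i _; rewrite coef_map.
rewrite (poly_def (size p)) rmorph_sum mulr_suml (reindex_inj rev_ord_inj) /=.
apply: eq_bigr => i _; rewrite -mul_polyC rmorphM rmorphXn -mulrA; congr (_ * _).
  by rewrite -subn1 -subnDA add1n.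
have lei : (i <= (size p).-1)%N by rewrite -ltnS prednK.
rewrite exprVn; apply: (mulfI (expf_neq0 (size p - i.+1) X0)).
rewrite mulrA divff ?expf_neq0 // mul1r -exprD; congr (_ ^+ _).
by rewrite -subn1 -[i.+1]add1n subnDA subnK // subn1.
Qed.

Lemma eval_inv_eq0 p : (eval_inv p == 0) = (p == 0).
Proof.
apply/idP/eqP => [|->]; last by rewrite rmorph0.
apply: contraTeq => p0.
suff: eval_inv p * f 'X ^+ (size p).-1 != 0.
  by rewrite mulf_eq0 negb_or => /andP[].
rewrite eval_inv_rev // f_eq0; apply/eqP => /(congr1 (fun r : {poly k} => r`_0)).
rewrite coef_poly size_poly_gt0 p0 subn0 coef0 => /eqP.
by rewrite -[_`__]/(lead_coef p) lead_coef_eq0 (negPf p0).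
Qed.

End EvalInverse.

Lemma malg_scalerAr (M : monomType) (R : comNzRingType) c (x y : {malg R[M]}) :
  c *: (x * y) = x * (c *: y).
Proof.
rewrite (malgMEw (fsubset_refl _) (msuppZ_le c y)) malgME scaler_sumr.
apply: eq_bigr => k1 _; rewrite scaler_sumr; apply: eq_bigr => k2 _.
by apply/malgP=> k; rewrite mcoeffZ !mcoeffU mcoeffZ mulrnAr mulrCA.
Qed.

Section QuantumMatrices.
Context (K : fieldType) (q : K) (n : nat).

(* The free associative algebra on the generators (i, j); the noncommutative
   monomials are words. *)
Local Notation free := {malg K[{fmonom ('I_n * 'I_n)%type}]}.

Definition gen (i j : 'I_n) : free := << fmu (i, j) >>.

Variant qrel : free -> free -> Prop :=
| qrel_row (i j k : 'I_n) of (j < k)%N :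
    qrel (gen i j * gen i k) (q ^+ 2 *: (gen i k * gen i j))
| qrel_col (i j k : 'I_n) of (i < k)%N :
    qrel (gen i j * gen k j) (q ^+ 2 *: (gen k j * gen i j))
| qrel_anti (i j s t : 'I_n) of (s < i)%N & (j < t)%N :
    qrel (gen i j * gen s t) (gen s t * gen i j)
| qrel_diag (i j s t : 'I_n) of (i < s)%N & (j < t)%N :
    qrel (gen i j * gen s t)
         (gen s t * gen i j + (q ^+ 2 - q ^- 2) *: (gen i t * gen s j)).

(* The two-sided ideal generated by the relations. *)
Inductive qideal : free -> Prop :=
| qideal_rel x y of qrel x y : qideal (x - y)
| qideal0 : qideal 0
| qidealB x y of qideal x & qideal y : qideal (x - y)
| qidealMl a x of qideal x : qideal (a * x)
| qidealMr a x of qideal x : qideal (x * a).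

Definition in_qideal (x : free) : bool := `[< qideal x >].

Lemma in_qideal_zmod_closed : zmod_closed in_qideal.
Proof.
split=> [|x y /asboolP Ix /asboolP Iy]; apply/asboolP; first exact: qideal0.
exact: qidealB.
Qed.

HB.instance Definition _ :=
  GRing.isZmodClosed.Build free in_qideal in_qideal_zmod_closed.

Definition Oq := {ideal_quot (GRing.ZmodClosed.clone free in_qideal _)}.

HB.instance Definition _ := GRing.Zmodule.on Oq.

Definition toOq (x : free) : Oq := \pi x.

Lemma toOqP (x : Oq) : exists y, x = toOq y.
Proof. by exists (repr x); rewrite /toOq reprK. Qed.

Lemma toOq_eq x y : toOq x = toOq y <-> qideal (x - y).
Proof.
split=> [/eqP|Ixy]; last by apply/eqP; rewrite -Quotient.idealrBE; apply/asboolP.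
by rewrite -Quotient.idealrBE => /asboolP.
Qed.

Lemma toOq_repr x : toOq (repr x) = x.
Proof. exact: reprK. Qed.

Lemma toOq_is_zmod_morphism : zmod_morphism toOq.
Proof. by move=> x y; rewrite /toOq !piE. Qed.

HB.instance Definition _ :=
  GRing.isZmodMorphism.Build free Oq toOq toOq_is_zmod_morphism.

Lemma free_scaleE c (x : free) : c *: x = c%:MP * x.
Proof. exact/esym/mul_malgC. Qed.

(* The product and the scaling are opaque, to keep unification from unfolding
   them: they are determined by toOq_mul and toOq_scale below. *)
Lemma Oq_mul_subproof :
  {m : Oq -> Oq -> Oq | forall x y, m (toOq x) (toOq y) = toOq (x * y)}.
Proof.
exists (fun x y => toOq (repr x * repr y)) => x y; apply/toOq_eq.
have Ix : qideal (repr (toOq x) - x) by apply/toOq_eq/toOq_repr.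
have Iy : qideal (repr (toOq y) - y) by apply/toOq_eq/toOq_repr.
move: (repr (toOq x)) (repr (toOq y)) Ix Iy => x' y' Ix Iy.
have -> : x' * y' - x * y = x' * (y' - y) - (0 - (x' - x) * y).
  by rewrite sub0r opprK mulrBr mulrBl addrA subrK.
apply: qidealB; first exact: qidealMl.
by apply: qidealB; [exact: qideal0 | exact: qidealMr].
Qed.

Lemma Oq_scale_subproof :
  {m : K -> Oq -> Oq | forall c x, m c (toOq x) = toOq (c *: x)}.
Proof.
exists (fun c x => toOq (c *: repr x)) => c x; apply/toOq_eq.
rewrite -scalerBr free_scaleE; apply: qidealMl.
by apply/toOq_eq/toOq_repr.
Qed.

Definition Oq_mul := sval Oq_mul_subproof.
Definition Oq_scale := sval Oq_scale_subproof.

Local Notation oneO := (toOq 1).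
Local Notation mulO := Oq_mul.
Local Notation scaleO := Oq_scale.

Lemma toOq_mul x y : Oq_mul (toOq x) (toOq y) = toOq (x * y).
Proof. exact: (svalP Oq_mul_subproof). Qed.

Lemma toOq_scale c x : Oq_scale c (toOq x) = toOq (c *: x).
Proof. exact: (svalP Oq_scale_subproof). Qed.

Lemma qideal_coef1 x : qideal x -> mcoeff (@mone _) x = 0.
Proof.
have genM i j i' j' : mcoeff (@mone _) (gen i j * gen i' j' : free) = 0.
  by rewrite rmorphM /= mcoeffU fm1_eq1 mul0r.
elim=> [y z qyz||y z _ y0 _ z0|y z _ z0|y z _ z0].
- rewrite mcoeffB; suff [-> ->] : mcoeff (@mone _) y = 0 /\ mcoeff (@mone _) z = 0.
    by rewrite subr0.
  have scalM c (i j i' j' : 'I_n) :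
    mcoeff (@mone _) (c *: (gen i j * gen i' j')) = 0.
    by rewrite mcoeffZ genM mulr0.
  case: qyz => [i j k _|i j k _|i j s t _ _|i j s t _ _]; split.
  - exact: genM.
  - exact: scalM.
  - exact: genM.
  - exact: scalM.
  - exact: genM.
  - exact: genM.
  - exact: genM.
  - rewrite mcoeffD.
    rewrite (genM s t i j).
    rewrite (scalM _ i t s j).
    exact: addr0.
- by rewrite raddf0.
- by rewrite raddfB /= y0 z0 subrr.
- by rewrite rmorphM /= z0 mulr0.
- by rewrite rmorphM /= z0 mul0r.
Qed.

Let mulOA : associative mulO.
Proof.
move=> x y z; have [x' ->] := toOqP x; have [y' ->] := toOqP y.
by have [z' ->] := toOqP z; rewrite !toOq_mul mulrA.
Qed.

Let mul1O : left_id oneO mulO.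
Proof. by move=> x; have [x' ->] := toOqP x; rewrite toOq_mul mul1r. Qed.

Let mulO1 : right_id oneO mulO.
Proof. by move=> x; have [x' ->] := toOqP x; rewrite toOq_mul mulr1. Qed.

Let mulODl : left_distributive mulO +%R.
Proof.
move=> x y z; have [x' ->] := toOqP x; have [y' ->] := toOqP y.
by have [z' ->] := toOqP z; rewrite -raddfD !toOq_mul mulrDl raddfD.
Qed.

Let mulODr : right_distributive mulO +%R.
Proof.
move=> x y z; have [x' ->] := toOqP x; have [y' ->] := toOqP y.
by have [z' ->] := toOqP z; rewrite -raddfD !toOq_mul mulrDr raddfD.
Qed.

Let oneO_neq0 : oneO != 0.
Proof.
apply/eqP; rewrite -(raddf0 toOq) => /toOq_eq; rewrite subr0 => /qideal_coef1.
by move/eqP; rewrite rmorph1 oner_eq0.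
Qed.

HB.instance Definition _ := GRing.Zmodule_isNzRing.Build Oq
  mulOA mul1O mulO1 mulODl mulODr oneO_neq0.

Let scaleOA a b x : scaleO a (scaleO b x) = scaleO (a * b) x.
Proof. by have [x' ->] := toOqP x; rewrite !toOq_scale scalerA. Qed.

Let scale1O : left_id 1 scaleO.
Proof. by move=> x; have [x' ->] := toOqP x; rewrite toOq_scale scale1r. Qed.

Let scaleODr : right_distributive scaleO +%R.
Proof.
move=> c x y; have [x' ->] := toOqP x; have [y' ->] := toOqP y.
by rewrite -raddfD !toOq_scale scalerDr raddfD.
Qed.

Let scaleODl x : {morph scaleO^~ x : a b / a + b}.
Proof.
by move=> a b; have [x' ->] := toOqP x; rewrite !toOq_scale scalerDl raddfD.
Qed.

HB.instance Definition _ := GRing.Zmodule_isLmodule.Build K Oq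
  scaleOA scale1O scaleODr scaleODl.

Let scaleOAl (c : K) (x y : Oq) : c *: (x * y) = (c *: x) * y.
Proof.
have [x' ->] := toOqP x; have [y' ->] := toOqP y.
rewrite [_ * _]toOq_mul [c *: toOq x']toOq_scale [LHS]toOq_scale [RHS]toOq_mul.
by rewrite scalerAl.
Qed.

Let scaleOAr (c : K) (x y : Oq) : c *: (x * y) = x * (c *: y).
Proof.
have [x' ->] := toOqP x; have [y' ->] := toOqP y.
rewrite [_ * _]toOq_mul [c *: toOq y']toOq_scale [LHS]toOq_scale [RHS]toOq_mul.
by rewrite malg_scalerAr.
Qed.

HB.instance Definition _ := GRing.Lmodule_isLalgebra.Build K Oq scaleOAl.
HB.instance Definition _ := GRing.Lalgebra_isAlgebra.Build K Oq scaleOAr.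

Lemma toOq_is_monoid_morphism : monoid_morphism toOq.
Proof. by split=> [|x y]; [|exact/esym/toOq_mul]. Qed.

Lemma toOq_is_scalable : scalable toOq.
Proof. by move=> c x; exact/esym/toOq_scale. Qed.

HB.instance Definition _ :=
  GRing.isMonoidMorphism.Build free Oq toOq toOq_is_monoid_morphism.
HB.instance Definition _ :=
  GRing.isScalable.Build K free Oq *:%R toOq toOq_is_scalable.

Definition Z (i j : 'I_n) : Oq := toOq (gen i j).

Lemma qrelE x y : qrel x y -> toOq x = toOq y.
Proof. by move=> xy; apply/toOq_eq; apply: qideal_rel. Qed.

Section Bar.
Context (phi : {rmorphism K -> K}).

(* The bar map, for an automorphism phi of K with phi q = q^-1: each word is
   reversed, and phi is applied to its coefficient. That this is well defined
   on Oq, additive and anti-multiplicative is barE, barB and barM below. *)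
Definition bar_word (m : {fmonom ('I_n * 'I_n)%type}) : Oq :=
  \prod_(p <- rev m) Z p.1 p.2.

Definition bar_free (x : free) : Oq :=
  \sum_(m <- msupp x) phi (mcoeff m x) *: bar_word m.

Definition bar (x : Oq) : Oq := bar_free (repr x).

Lemma bar_freeEw (d : {fset {fmonom ('I_n * 'I_n)%type}}) x :
  (msupp x `<=` d)%fset ->
  bar_free x = \sum_(m <- d) phi (mcoeff m x) *: bar_word m.
Proof.
move=> le; rewrite /bar_free (big_fset_incl _ le) //= => m _ /mcoeff_outdom ->.
by rewrite raddf0 scale0r.
Qed.

Lemma bar_free_is_zmod_morphism : zmod_morphism bar_free.
Proof.
move=> x y; set d := (msupp x `|` msupp y `|` msupp (x - y))%fset.
have dx : (msupp x `<=` d)%fset by rewrite /d -fsetUA fsubsetUl.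
have dy : (msupp y `<=` d)%fset by rewrite /d fsetUAC fsubsetUr.
have dxy : (msupp (x - y) `<=` d)%fset by rewrite fsubsetUr.
rewrite (bar_freeEw dx) (bar_freeEw dy) (bar_freeEw dxy).
by rewrite -sumrB; apply: eq_bigr => m _; rewrite !raddfB /= scalerBl.
Qed.

HB.instance Definition _ :=
  GRing.isZmodMorphism.Build free Oq bar_free bar_free_is_zmod_morphism.

Lemma bar_freeU c m : bar_free << c *g m >> = phi c *: bar_word m.
Proof.
by rewrite (bar_freeEw msuppU_le) big_seq_fset1 mcoeffUU.
Qed.

Lemma bar_wordM m1 m2 : bar_word (mmul m1 m2) = bar_word m2 * bar_word m1.
Proof. by rewrite /bar_word fmM rev_cat big_cat. Qed.

Lemma bar_freeM x y : bar_free (x * y) = bar_free y * bar_free x.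
Proof.
have -> : bar_free y * bar_free x =
    \sum_(m1 <- msupp x) \sum_(m2 <- msupp y)
      (phi (mcoeff m2 y) *: bar_word m2) * (phi (mcoeff m1 x) *: bar_word m1).
  by rewrite /bar_free mulr_sumr; apply: eq_bigr => m1 _; rewrite mulr_suml.
rewrite malgME raddf_sum; apply: eq_bigr => m1 _.
rewrite raddf_sum; apply: eq_bigr => m2 _ /=.
by rewrite bar_freeU bar_wordM rmorphM -scalerAl -scalerAr scalerA mulrC.
Qed.

Lemma bar_freeZ c x : bar_free (c *: x) = phi c *: bar_free x.
Proof.
rewrite (bar_freeEw (msuppZ_le c x)) scaler_sumr; apply: eq_bigr => m _.
by rewrite mcoeffZ rmorphM scalerA.
Qed.

Lemma bar_free_gen i j : bar_free (gen i j) = Z i j.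
Proof.
by rewrite bar_freeU rmorph1 scale1r /bar_word fmU big_seq1.
Qed.

Context (q_neq0 : q != 0) (phi_q : phi q = q^-1).

Lemma bar_free_rel x y : qrel x y -> bar_free x = bar_free y.
Proof.
have phiV : phi (q ^+ 2) = q ^- 2 by rewrite rmorphXn /= phi_q exprVn.
have q2K : q ^- 2 * q ^+ 2 = 1 by rewrite mulVf ?expf_neq0.
have ZE i j s t : Z i j * Z s t = toOq (gen i j * gen s t).
  exact: toOq_mul.
have ZZE c i j s t : c *: (Z i j * Z s t) = toOq (c *: (gen i j * gen s t)).
  by rewrite ZE; exact: toOq_scale.
have bM i j s t : bar_free (gen i j * gen s t) = Z s t * Z i j.
  rewrite (bar_freeM (gen i j) (gen s t)) (bar_free_gen i j) (bar_free_gen s t).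
  exact: erefl.
have bZM c i j s t :
  bar_free (c *: (gen i j * gen s t)) = phi c *: (Z s t * Z i j).
  by rewrite (bar_freeZ c (gen i j * gen s t)) bM.
case=> {x y} [i j k jk|i j k ik|i j s t si jt|i j s t si jt].
- apply: etrans (bM _ _ _ _) _; apply: esym; apply: etrans (bZM _ _ _ _ _) _.
  rewrite phiV ZE (qrelE (qrel_row i jk)) -ZZE scalerA q2K scale1r.
  exact: erefl.
- apply: etrans (bM _ _ _ _) _; apply: esym; apply: etrans (bZM _ _ _ _ _) _.
  rewrite phiV ZE (qrelE (qrel_col j ik)) -ZZE scalerA q2K scale1r.
  exact: erefl.
- apply: etrans (bM _ _ _ _) _; apply: esym; apply: etrans (bM _ _ _ _) _.
  by rewrite ZE (qrelE (qrel_anti si jt)) -ZE; exact: erefl.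
- apply: etrans (bM _ _ _ _) _; apply: esym.
  apply: etrans (raddfD bar_free _ _) _.
  apply: etrans (congr2 +%R (bM _ _ _ _) (bZM _ _ _ _ _)) _.
  have Zdiag : Z i j * Z s t =
      Z s t * Z i j + (q ^+ 2 - q ^- 2) *: (Z i t * Z s j).
    rewrite ZE (qrelE (qrel_diag si jt)).
    exact: etrans (raddfD toOq _ _)
      (congr2 +%R (esym (ZE _ _ _ _)) (esym (ZZE _ _ _ _ _))).
  have Zanti : Z s j * Z i t = Z i t * Z s j.
    by rewrite ZE (qrelE (qrel_anti si jt)) -ZE; exact: erefl.
  have phiB : phi (q ^+ 2 - q ^- 2) = - (q ^+ 2 - q ^- 2).
    by rewrite rmorphB fmorphV phiV invrK opprB.
  rewrite Zanti Zdiag phiB scaleNr.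
  exact: addrK.
Qed.

Lemma bar_free_ideal x : qideal x -> bar_free x = 0.
Proof.
elim=> {x} [x y xy||x y _ x0 _ y0|a x _ x0|a x _ x0].
- by rewrite raddfB /= (bar_free_rel xy) subrr.
- by rewrite raddf0.
- by rewrite raddfB /= x0 y0 subrr.
- by rewrite bar_freeM x0 mul0r.
- by rewrite bar_freeM x0 mulr0.
Qed.

Lemma barE x : bar (toOq x) = bar_free x.
Proof.
apply/eqP; rewrite /bar -subr_eq0 -[_ - _]raddfB; apply/eqP/bar_free_ideal.
by apply/toOq_eq; rewrite toOq_repr.
Qed.

Lemma barB : {morph bar : x y / x - y}.
Proof.
move=> x y; have [x' ->] := toOqP x; have [y' ->] := toOqP y.
by rewrite -raddfB !barE raddfB.
Qed.

Lemma barM x y : bar (x * y) = bar y * bar x.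
Proof.
have [x' ->] := toOqP x; have [y' ->] := toOqP y.
by rewrite -rmorphM !barE bar_freeM.
Qed.

Lemma barZ c x : bar (c *: x) = phi c *: bar x.
Proof.
by have [x' ->] := toOqP x; rewrite -linearZ !barE bar_freeZ.
Qed.

Lemma bar_gen i j : bar (Z i j) = Z i j.
Proof. by rewrite barE bar_free_gen. Qed.

End Bar.

(* The length l(s) of s is its number of inversions. *)
Definition perm_length (s : 'S_n) : nat :=
  #|[set p : 'I_n * 'I_n | (p.1 < p.2)%N && (s p.2 < s p.1)%N]|.

Definition det_q : Oq :=
  \sum_(s : 'S_n) (- q ^+ 2) ^+ perm_length s *: \prod_(i < n) Z i (s i).

Implicit Types A B : 'M[nat]_n.

(* Z^A: big products are taken in increasing order of the indices. *)
Definition Zmon A : Oq := \prod_(i < n) \prod_(j < n) Z i j ^+ A i j.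

Definition Dexp A : nat :=
  (\sum_(i < n) \sum_(j < n) \sum_(k < n | k < j) A i j * A i k
   + \sum_(i < n) \sum_(j < n) \sum_(k < n | k < j) A j i * A k i)%N.

(* Z(A) = D(A) Z^A with D(A) = q^(- Dexp A) *)
Definition Znorm A : Oq := q ^- Dexp A *: Zmon A.

Definition ro A : 'cV[nat]_n := \col_i \sum_j A i j.
Definition co A : 'rV[nat]_n := \row_j \sum_i A i j.

(* At the lexicographically first position (i, j) where B and A differ,
   B i j < A i j. *)
Definition lexmx B A : Prop :=
  exists i j, (B i j < A i j)%N /\
    forall s t : 'I_n, (s < i)%N \/ s = i /\ (t < j)%N -> B s t = A s t.

(* For K = Q(q), with q the variable, this is the inclusion of Z[q] in K. *)
Definition ofZq (p : {poly int}) : K := (map_poly intr p).[q].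

(* Z[q]-linear combinations of a family indexed by matrices; an element of
   {malg {poly int}['M[nat]_n]} is a finitely supported function. *)
Definition lincomb (f : 'M[nat]_n -> Oq) (c : {malg {poly int}['M[nat]_n]}) :
    Oq :=
  \sum_(A <- msupp c) ofZq (mcoeff A c) *: f A.

Definition Lstar (x : Oq) : Prop := exists c, x = lincomb Znorm c.

Definition is_Zq_basis (L : Oq -> Prop) (f : 'M[nat]_n -> Oq) : Prop :=
  (forall A, L (f A)) /\ (forall x, L x -> exists! c, x = lincomb f c).

End QuantumMatrices.

Definition Kq : fieldType := {fraction {poly rat}}.

Definition polyK : {rmorphism {poly rat} -> Kq} := tofrac.

Lemma polyK_eq0 p : (polyK p == 0) = (p == 0).
Proof. exact: tofrac_eq0. Qed.

Definition q : Kq := polyK 'X.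

Lemma q_neq0 : q != 0.
Proof. by rewrite polyK_eq0 polyX_eq0. Qed.

(* The automorphism of Q(q) over Q sending q to q^-1. *)
Definition barK : Kq -> Kq := frac_lift (eval_inv polyK).

HB.instance Definition _ := GRing.isZmodMorphism.Build Kq Kq barK
  (frac_lift_is_zmod_morphism (eval_inv_eq0 polyK_eq0)).
HB.instance Definition _ := GRing.isMonoidMorphism.Build Kq Kq barK
  (frac_lift_is_monoid_morphism (eval_inv_eq0 polyK_eq0)).

Lemma barKq : barK q = q^-1.
Proof.
have -> : barK q = eval_inv polyK 'X.
  exact: (frac_lift_tofrac (eval_inv_eq0 polyK_eq0)).
by rewrite /eval_inv map_polyX hornerX.
Qed.

(* B^* is given as the family b : A |-> b(A); Bstar_basis also contains the
   directness of the sum L^* = (+)_A Z[q] Z(A), by triangularity. *)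
Record is_Bstar (n : nat) (b : 'M[nat]_n -> Oq q n) : Prop := {
  Bstar_basis : is_Zq_basis (@Lstar _ q n) b;
  Bstar_bar : forall A, bar barK (b A) = b A;
  Bstar_triangular : forall A, exists h : {malg {poly int}['M[nat]_n]},
    b A = Znorm q A + lincomb (@Znorm _ q n) h /\
    forall B, B \in msupp h ->
      [/\ lexmx B A, ro B = ro A, co B = co A
        & exists p : {poly int}, mcoeff B h = 'X * p]
}.

(* Main.v *)
Require Import Defs.
From HB Require Import structures.
From mathcomp Require Import all_boot all_order all_fingroup all_algebra.
From mathcomp Require Import finmap monalg.
From mathcomp Require Import ring zify.
Import GRing.Theory.
Local Open Scope ring_scope.

(* Expand det_q along the rows, and move it through Z^A one row at a time. Between
   two columns the state is either a minor of the rows below, or a partial expansion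
   of the current row; passing Z_ij^a only changes this state by a two-term rule
   (as in a vertex model), so no cancellation occurs. With the weights q^(a(a+1))
   for the incoming and q^(c(c-1)) for the outgoing powers, all coefficients are in
   Z[q], and the row and column sums turn these weights into the normalization D.
   Hence det_q Z(A) is Z(A + I) modulo qL^*. Since det_q is central and bar-invariant,
   det_q b(A) is bar-invariant as well and has the same leading term as b(A + I);
   a bar-invariant element of qL^* is 0, because its coordinates on B^* would lie in
   both qZ[q] and q^-1 Z[q^-1]. *)

Set Implicit Arguments.
Unset Strict Implicit.
Unset Printing Implicit Defensive.

(** One of the local rules has the coefficient 1 - q^(4a), which q does not divide, so working
    modulo q requires following the path of the leading term. When row i is reached on it, the
    columns still to be used are those from i on. Before the diagonal row i meets only used columns,
    after it only needed ones, and there each rule has a single term with coefficient 1. The only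
    branching is at the diagonal, where the deviating term carries q^(2a+2); beyond that,
    integrality is enough. Centrality needs a separate argument, because an entry of row i is only
    moved through minors of rows below i. A row i is prefixed to the expansion of det_q along column
    k, and the result is evaluated in two ways. Bar-invariance holds because an expansion along the
    top row can also be written with the entries on the right and -q^2 inverted. The weights come
    from the identity that the exponent of D plus the sum of the squared entries is half the sum of
    the squared row and column sums. *)

Section Counting.
Context (n : nat).
Implicit Types J : {set 'I_n}.

Definition cnt J (k j : nat) : nat := (\sum_(m in J) (k <= m < j))%N.

Lemma cntD1 J (m : 'I_n) k j : m \in J ->
  cnt J k j = ((k <= m < j) + cnt (J :\ m) k j)%N.
Proof. by move=> mJ; rewrite /cnt (big_setD1 m). Qed.

Lemma cntU1 J (m : 'I_n) k j : m \notin J ->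
  cnt (m |: J) k j = ((k <= m < j) + cnt J k j)%N.
Proof. by move=> mJ; rewrite /cnt big_setU1. Qed.

Lemma cnt_split J k m j : (k <= m <= j)%N -> cnt J k j = (cnt J k m + cnt J m j)%N.
Proof.
by move=> kmj; rewrite /cnt -big_split /=; apply: eq_bigr => a _; lia.
Qed.

Lemma cnt0 J k j : (j <= k)%N -> cnt J k j = 0%N.
Proof. by move=> jk; rewrite /cnt big1 // => a _; lia. Qed.

Lemma cntS J (k : 'I_n) : cnt J k k.+1 = (k \in J).
Proof.
case: (boolP (k \in J)) => kJ.
  rewrite (cntD1 _ _ kJ) leqnn ltnSn /= /cnt big1 // => m; rewrite !inE => /andP[mk _].
  by apply/eqP; rewrite eqb0; apply/negP => h; case/eqP: mk; apply/val_inj => /=; lia.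
rewrite /cnt big1 // => m mJ; apply/eqP; rewrite eqb0; apply/negP => h.
have mk : m = k by apply/val_inj => /=; lia.
by move: kJ; rewrite -mk mJ.
Qed.

Lemma cntSl J (k : 'I_n) (j : nat) : (k < j)%N -> cnt J k j = ((k \in J) + cnt J k.+1 j)%N.
Proof. by move=> kj; rewrite (@cnt_split _ k k.+1) ?cntS //; lia. Qed.

Lemma cnt0_lt J (k : 'I_n) (j : nat) : (k < j)%N ->
  cnt J 0 j = (cnt J 0 k + ((k \in J) + cnt J k.+1 j))%N.
Proof. by move=> kj; rewrite -cntSl // -cnt_split //= ltnW. Qed.

Lemma cntD_lt J (j : 'I_n) m l : j \in J -> (m <= j)%N -> (j < l)%N ->
  cnt J m l = (cnt (J :\ j) m l).+1.
Proof. by move=> jJ mj jl; rewrite (cntD1 _ _ jJ) mj jl. Qed.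

Lemma cntD_out J (l : 'I_n) m j : ~~ (m <= l < j)%N -> cnt (J :\ l) m j = cnt J m j.
Proof.
case: (boolP (l \in J)) => lJ; first by move=> h; rewrite (cntD1 _ _ lJ) (negPf h).
by move=> _; congr cnt; apply/setP=> a; rewrite !inE; case: eqP => // ->; rewrite (negPf lJ).
Qed.

Lemma cntU_out J (l : 'I_n) m j : ~~ (m <= l < j)%N -> cnt (l |: J) m j = cnt J m j.
Proof.
case: (boolP (l \in J)) => lJ h; last by rewrite cntU1 // (negPf h).
by rewrite (setUidPr _) // sub1set.
Qed.

Lemma setD1C J (j l : 'I_n) : J :\ l :\ j = J :\ j :\ l.
Proof. by rewrite !setDDl setUC. Qed.

End Counting.

(** Stated for any algebra, so that the expansions never see the quotient construction; [Oq_qmatrix]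
    supplies the instance. *)
Record qmatrix (K : fieldType) (q : K) (n : nat) (R : algType K)
    (Z : 'I_n -> 'I_n -> R) : Prop := QMatrix {
  Zrow : forall i j k : 'I_n, (j < k)%N ->
    Z i j * Z i k = q ^+ 2 *: (Z i k * Z i j);
  Zcol : forall i j k : 'I_n, (i < k)%N ->
    Z i j * Z k j = q ^+ 2 *: (Z k j * Z i j);
  Zanti : forall i j s u : 'I_n, (s < i)%N -> (j < u)%N ->
    Z i j * Z s u = Z s u * Z i j;
  Zdiag : forall i j s u : 'I_n, (i < s)%N -> (j < u)%N ->
    Z i j * Z s u = Z s u * Z i j + (q ^+ 2 - q ^- 2) *: (Z i u * Z s j) }.

(** * Quantum minors by row expansion, and their commutation with an entry of a higher row *)

Section QuantumMinors.
Context (K : fieldType) (q : K) (n : nat) (R : algType K).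
Context (Z : 'I_n -> 'I_n -> R).

Local Notation t := (- q ^+ 2).
Local Notation lam := (q ^+ 2 - q ^- 2).

Implicit Types (J : {set 'I_n}) (F : {set 'I_n} -> R).

(* The part of the expansion of a minor along row i that uses the columns from k on,
   F giving the complementary minors; the signs are counted from column k. *)
Definition prow (k : nat) (i : 'I_n) F J : R :=
  \sum_(j in J | (k <= j)%N) t ^+ cnt J k j *: (Z i j * F (J :\ j)).

(** No condition relates [w] and [J]: the base case makes the value 0 when their sizes differ. *)
Fixpoint minor (w : seq 'I_n) J : R :=
  if w is i :: w' then prow 0 i (minor w') J else (J == set0)%:R.

(* How a minor F of rows below i commutes with the entries of row i. *)
Definition commrow (i : 'I_n) F : Prop := forall J (k : 'I_n),
  F J * Z i k = if k \in J then q ^- 2 *: (Z i k * F J)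
                else Z i k * F J - lam *: prow k.+1 i F (k |: J).

Lemma eq_prow k i F G J : (forall J, F J = G J) -> prow k i F J = prow k i G J.
Proof. by move=> FG; apply: eq_bigr => j _; rewrite FG. Qed.

Lemma prow0 k i J : prow k i (fun=> 0) J = 0.
Proof. by rewrite /prow big1 // => j _; rewrite mulr0 scaler0. Qed.

Lemma prow_nil i F J : prow n i F J = 0.
Proof. by rewrite /prow big1 // => j /andP[_]; rewrite leqNgt ltn_ord. Qed.

Lemma prow_in (k : 'I_n) i F J : k \in J ->
  prow k i F J = Z i k * F (J :\ k) + t *: prow k.+1 i F J.
Proof.
move=> kJ; rewrite /prow (bigD1 k) /= ?kJ ?leqnn // cnt0 // expr0 scale1r.
congr (_ + _); rewrite scaler_sumr; apply: eq_big => [j|j /andP[/andP[jJ kj] jk]].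
  by rewrite -andbA; congr (_ && _); rewrite -val_eqE /=; lia.
have lt_kj : (k < j)%N by rewrite ltn_neqAle kj eq_sym andbT.
by rewrite scalerA -exprS cntSl // kJ.
Qed.

Lemma prow_notin (k : 'I_n) i F J : k \notin J -> prow k i F J = prow k.+1 i F J.
Proof.
move=> kJ; apply: eq_big => [j|j /andP[jJ kj]].
  case: (boolP (j \in J)) => //= jJ.
  have : j != k by apply: contraNneq kJ => <-.
  by rewrite -val_eqE /=; lia.
rewrite cntSl ?(negPf kJ) // ltn_neqAle kj andbT.
by apply: contraNneq kJ => /val_inj ->.
Qed.

Lemma pair_sum J (f : 'I_n -> 'I_n -> R) (P : pred 'I_n) :
  \sum_(j in J | P j) \sum_(l in J :\ j | P l) f j l =
  \sum_(j in J | P j) \sum_(l in J :\ j | P l && (j < l)%N) (f j l + f l j).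
Proof.
under [RHS]eq_bigr => j _ do rewrite big_split.
rewrite big_split /= [X in _ = _ + X](exchange_big_dep (fun j => (j \in J) && P j)) /=; last first.
  by move=> i j; rewrite !inE => /andP[_ _] /andP[/andP[_ ->]] /andP[->].
rewrite -big_split; apply: eq_bigr => j /andP[jJ Pj] /=.
rewrite (bigID (fun l : 'I_n => j < l)%N) /=; congr (_ + _).
  by apply: eq_bigl => l; rewrite andbA.
apply: eq_bigl => l; rewrite !inE jJ Pj /=.
by rewrite -!val_eqE /=; case: (l \in J); case: (P l) => /=; lia.
Qed.

Context (q_neq0 : q != 0) (qZ : qmatrix q Z).

Lemma t_neq0 : t != 0.
Proof. by rewrite oppr_eq0 expf_neq0. Qed.

Lemma ZrowV i (j k : 'I_n) : (j < k)%N -> Z i k * Z i j = q ^- 2 *: (Z i j * Z i k).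
Proof.
by move=> jk; rewrite (Zrow qZ i jk) scalerA mulVf ?scale1r // expf_neq0.
Qed.

Lemma ZcolV (i s k : 'I_n) : (i < s)%N -> Z s k * Z i k = q ^- 2 *: (Z i k * Z s k).
Proof.
by move=> jk; rewrite (Zcol qZ k jk) scalerA mulVf ?scale1r // expf_neq0.
Qed.

Lemma ZdiagV (i s j l : 'I_n) : (i < s)%N -> (j < l)%N ->
  Z s l * Z i j = Z i j * Z s l - lam *: (Z i l * Z s j).
Proof. by move=> is_ jl; rewrite (Zdiag qZ is_ jl) addrK. Qed.

(** Choosing two columns in the opposite order costs exactly one factor t, so the terms pair up into
    2x2 minors. *)
Lemma prow_prowE m i s F J : prow m s (prow m i F) J =
  \sum_(j in J | (m <= j)%N) \sum_(l in J :\ j | (m <= l)%N && (j < l)%N)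
     t ^+ (cnt J m j + cnt (J :\ j) m l) *:
       ((Z s j * Z i l + t *: (Z s l * Z i j)) * F (J :\ j :\ l)).
Proof.
pose f (j l : 'I_n) : R := t ^+ (cnt J m j + cnt (J :\ j) m l) *:
  (Z s j * Z i l * F (J :\ j :\ l)).
transitivity (\sum_(j in J | (m <= j)%N) \sum_(l in J :\ j | (m <= l)%N) f j l).
  apply: eq_bigr => j _; rewrite [prow _ _ _ (_ :\ _)]/prow mulr_sumr scaler_sumr.
  by apply: eq_bigr => l _; rewrite -scalerAr scalerA mulrA -exprD.
rewrite pair_sum; apply: eq_bigr => j /andP[jJ mj]; apply: eq_bigr => l.
rewrite !inE => /andP[/andP[lj lJ] /andP[ml jl]]; rewrite /f setD1C.
rewrite mulrDl scalerDr -scalerAl scalerA -exprSr; congr (_ + _ ^+ _ *: _).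
rewrite (cntD_lt jJ mj jl) (@cntD_out _ J l m j) 1?addnC ?addnS //; lia.
Qed.

Lemma prow_prow m i F J : prow m i (prow m i F) J = 0.
Proof.
rewrite prow_prowE big1 // => j _; rewrite big1 // => l /and3P[_ _ jl].
rewrite (Zrow qZ i jl) -scalerDl.
by rewrite subrr scale0r mul0r scaler0.
Qed.

(** On 2x2 minors this is the identity 1 - t lam = t^2. *)
Lemma prowC m (i s : 'I_n) F J : (i < s)%N ->
  prow m s (prow m i F) J = t *: prow m i (prow m s F) J.
Proof.
move=> is_; rewrite !prow_prowE scaler_sumr; apply: eq_bigr => j _.
rewrite scaler_sumr; apply: eq_bigr => l /and3P[_ _ jl].
rewrite [RHS]scalerA [t * _]mulrC -[RHS]scalerA [X in _ = _ *: X]scalerAl; congr (_ *: (_ * _)).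
rewrite (ZdiagV is_ jl) (Zanti qZ is_ jl) scalerBr scalerDr !scalerA addrCA; congr (_ + _).
by rewrite -[X in X - _]scale1r -scalerBl; congr (_ *: _); field.
Qed.

Lemma prowD k i F G J : prow k i (fun J => F J + G J) J = prow k i F J + prow k i G J.
Proof.
by rewrite /prow -big_split; apply: eq_bigr => j _; rewrite mulrDr scalerDr.
Qed.

Lemma prowZ k i a F J : prow k i (fun J => a *: F J) J = a *: prow k i F J.
Proof.
rewrite /prow scaler_sumr; apply: eq_bigr => j _.
by rewrite -scalerAr !scalerA mulrC.
Qed.

Lemma prowMr k i F z J : prow k i (fun J => F J * z) J = prow k i F J * z.
Proof.
by rewrite /prow mulr_suml; apply: eq_bigr => j _; rewrite -scalerAl mulrA.
Qed.

(** The correction vanishes because column k is never removed from [k |: J] there. *)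
Lemma commrow_nil i : commrow i (minor [::]).
Proof.
move=> J k /=; have [->|J0] := eqVneq J set0.
  rewrite inE mul1r mulr1 /prow big1 ?scaler0 ?subr0 // => j.
  rewrite setU0 inE => /andP[/eqP->]; by rewrite ltnn.
have -> : lam *: prow k.+1 i (minor [::]) (k |: J) = 0.
  rewrite /prow big1 ?scaler0 // => j /andP[_ kj] /=.
  rewrite (_ : _ == set0 = false) ?mulr0 ?scaler0 //.
  apply/negbTE/set0Pn; exists k; rewrite !inE eqxx andbT.
  by rewrite -val_eqE /= neq_ltn kj.
by rewrite /= mul0r mulr0 subr0 scaler0 if_same.
Qed.

Lemma prow0E i F J :
  prow 0 i F J = \sum_(j in J) t ^+ cnt J 0 j *: (Z i j * F (J :\ j)).
Proof. by apply: eq_bigl => j; rewrite leq0n andbT. Qed.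

(** The induction step on the rows below i: an entry of row i is moved first through F, then through
    the entry of row s. *)
Lemma commrow_prow (i s : 'I_n) F : (i < s)%N -> commrow i F -> commrow i (prow 0 s F).
Proof.
move=> is_ FE J k; rewrite prow0E mulr_suml; case: ifPn => kJ.
  (* [g] collects the corrections: for j = k from moving through F, for j > k from the diagonal
     relation. *)
  pose H (j : 'I_n) : R := t ^+ cnt J 0 j *: (Z s j * F (J :\ j)).
  pose g (j : 'I_n) : R := if j == k then lam * t ^+ cnt J 0 k *: (Z s k * prow k.+1 i F J)
    else if (k < j)%N then lam * q ^- 2 * t ^+ cnt J 0 j *: (Z i j * Z s k * F (J :\ j))
    else 0.
  rewrite (eq_bigr (fun j : 'I_n => q ^- 2 *: (Z i k * H j) - g j)); last first.
    move=> j jJ; rewrite -scalerAl -mulrA /H /g FE in_setD1 kJ andbT.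
    have [->|jk] := eqVneq j k.
      rewrite /= setD1K // mulrBr mulrA (ZcolV _ is_) -scalerAr scalerBr.
      by rewrite -!scalerAl -!scalerAr !scalerA !mulrA [_ * lam]mulrC [q ^- 2 * _]mulrC.
    rewrite /= -!scalerAr mulrA; case: ltnP => kj.
      rewrite (ZdiagV is_ kj) mulrBl !scalerBr -scalerAl !scalerA !mulrA.
      by congr (_ *: _ - _ *: _); ring.
    have lt_jk : (j < k)%N by rewrite ltn_neqAle kj jk.
    by rewrite (Zanti qZ is_ lt_jk) subr0 !scalerA mulrC mulrA.
  rewrite sumrB -scaler_sumr -mulr_sumr -[RHS]subr0; congr (_ - _).
  rewrite (bigD1 k) //= {1}/g eqxx mulr_sumr scaler_sumr.
  have -> : \sum_(j in J | j != k) g j = \sum_(j in J | (k < j)%N) g j.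
    rewrite [RHS]big_mkcondr [LHS]big_mkcondr; apply: eq_bigr => j jJ.
    by rewrite /g; case: eqP => [->|]; rewrite ?ltnn //=; case: ltnP.
  (* The two corrections cancel column by column: column k counts once in [cnt J 0 l], and q^-2 t =
     -1. *)
  rewrite -big_split big1 // => l /andP[lJ kl] /=.
  have lk : l != k by rewrite -val_eqE /= neq_ltn kl orbT.
  rewrite /g (negPf lk) kl -scalerAr scalerA mulrA (Zanti qZ is_ kl) -scalerDl.
  rewrite (cnt0_lt _ kl) kJ !exprD expr1.
  by rewrite [X in X *: _](_ : _ = 0) ?scale0r //; field.
(* In [c] row s receives column k through the diagonal relation, in [d] column k goes into F. They
   will match the terms of [prow 0 s F] with s in column k and with s in another column. *)
pose c (j : 'I_n) : R :=
  if (k < j)%N then t ^+ cnt J 0 j *: (Z i j * Z s k * F (J :\ j)) else 0.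
pose d (j : 'I_n) : R := t ^+ cnt J 0 j *: (Z s j * prow k.+1 i F (k |: J :\ j)).
rewrite (eq_bigr (fun j : 'I_n => Z i k * (t ^+ cnt J 0 j *: (Z s j * F (J :\ j))) -
   lam *: (c j + d j))); last first.
  move=> j jJ; rewrite -scalerAl -mulrA /c /d FE in_setD1 (negPf kJ) andbF.
  rewrite mulrBr mulrA scalerBr -!scalerAr.
  have jk : j != k by apply: contraNneq kJ => <-.
  case: ltnP => kj.
    rewrite (ZdiagV is_ kj) mulrBl !scalerBr -scalerAl mulrA scalerDr opprD addrA.
    by rewrite !scalerA [_ * lam]mulrC.
  have lt_jk : (j < k)%N by rewrite ltn_neqAle kj jk.
  by rewrite (Zanti qZ is_ lt_jk) add0r mulrA !scalerA [_ * lam]mulrC.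
rewrite sumrB -mulr_sumr -scaler_sumr big_split /=; congr (_ - _ *: _).
have {c} -> : \sum_(j in J) c j = \sum_(l in J | (k < l)%N)
    t ^+ cnt J 0 l *: (Z i l * Z s k * F (J :\ l)).
  by rewrite big_mkcondr.
pose e (j l : 'I_n) := (cnt J 0 j + cnt (J :\ j) k.+1 l)%N.
pose G (l j : 'I_n) : R := Z i l * Z s j * F (k |: J :\ l :\ j).
have {d} -> : \sum_(j in J) d j = \sum_(l in J | (k < l)%N) \sum_(j in J :\ l)
    t ^+ e j l *: (Z s j * Z i l * F (k |: J :\ l :\ j)).
  rewrite [RHS](exchange_big_dep (mem J)) /=; last first.
    by move=> l j _; rewrite inE => /andP[].
  apply: eq_bigr => j jJ; rewrite /d /prow mulr_sumr scaler_sumr.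
  apply: eq_big => [l|l].
    rewrite !inE jJ andbT; case: (eqVneq l k) => [->|lk] /=.
      by rewrite ltnn andbF.
    by rewrite [j == l]eq_sym; case: (l \in J); case: (l == j); case: (k < l)%N.
  rewrite !inE => /andP[/orP[/eqP->|/andP[lj lJ]] kl]; first by rewrite ltnn in kl.
  have lk : k != l by rewrite -val_eqE /= neq_ltn kl.
  rewrite -scalerAr scalerA -exprD mulrA setD1C cntU_out ?leqnn ?ltnn //.
  congr (_ *: (_ * F _)); apply/setP => a; rewrite !inE.
  by case: (eqVneq a k) => [->|]; rewrite ?lk.
have swap : forall l j : 'I_n, (k < l)%N -> j \in J :\ l ->
    t ^+ e j l *: (Z s j * Z i l * F (k |: J :\ l :\ j)) =
    t ^+ e j l *: G l j - (if (l < j)%N then lam * t ^+ e j l *: G j l else 0).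
  move=> l j kl; rewrite !inE => /andP[jl jJ]; rewrite /G; case: ltnP => lj.
    by rewrite (ZdiagV is_ lj) mulrBl -scalerAl scalerBr scalerA [_ * lam]mulrC [J :\ j :\ l]setD1C.
  by rewrite (Zanti qZ is_) ?subr0 // ltn_neqAle jl.
(* The corrections from [swap] have j and l interchanged; reindexed, they change only the
   coefficients with k < j < l. *)
have -> : \sum_(l in J | (k < l)%N) \sum_(j in J :\ l)
      t ^+ e j l *: (Z s j * Z i l * F (k |: J :\ l :\ j)) =
    \sum_(l in J | (k < l)%N) \sum_(j in J :\ l)
      ((t ^+ e j l - (k < j < l)%:R * lam * t ^+ e l j) *: G l j).
  transitivity (\sum_(l in J | (k < l)%N) \sum_(j in J :\ l) t ^+ e j l *: G l j -
    \sum_(l in J | (k < l)%N) \sum_(j in J :\ l | (l < j)%N) lam * t ^+ e j l *: G j l).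
    rewrite -sumrB; apply: eq_bigr => l /andP[_ kl]; rewrite [X in _ - X]big_mkcondr.
    by rewrite -sumrB; apply: eq_bigr => j jJ; apply: swap.
  rewrite [X in _ - X](exchange_big_dep (fun j => (j \in J) && (k < j)%N)) /=; last first.
    by move=> l j /andP[lJ kl]; rewrite !inE => /andP[/andP[_ ->] lj]; apply: ltn_trans lj.
  rewrite -sumrB; apply: eq_bigr => l /andP[lJ kl].
  under [RHS]eq_bigr => j _ do rewrite scalerBl.
  rewrite sumrB; congr (_ - _).
  rewrite [LHS](_ : _ = \sum_(j in J :\ l | (k < j < l)%N) lam * t ^+ e l j *: G l j).
    rewrite big_mkcondr; apply: eq_bigr => j _; case: ifP; rewrite ?mul1r ?mul0r ?scale0r //.
  apply: eq_bigl => j; rewrite !inE lJ /= andbT [l == j]eq_sym.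
  by case: (j \in J); case: (j == l); case: (k < j)%N; case: (j < l)%N.
rewrite -big_split /= [prow k.+1 i _ _]/prow [RHS]big_mkcondr big_setU1 //= ltnn add0r -big_mkcondr.
apply: eq_bigr => l /andP[lJ kl]; rewrite prow0E.
have kl' : k != l by rewrite -val_eqE /= neq_ltn kl.
have -> : (k |: J) :\ l = k |: J :\ l.
  by apply/setP => a; rewrite !inE; case: (eqVneq a k) => [->|]; rewrite ?kl'.
have kJl : k \notin J :\ l by rewrite inE (negPf kJ) andbF.
rewrite big_setU1 //= mulrDr scalerDr setU1K // cntU_out ?leqnn ?ltnn //.
congr (_ + _).
  rewrite -scalerAr scalerA mulrA -exprD cntU_out ?ltnn ?andbF //.
  by rewrite cntD_out; [rewrite (cnt0_lt _ kl) (negPf kJ) addnC|lia].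
rewrite mulr_sumr scaler_sumr; apply: eq_bigr => j; rewrite !inE => /andP[jl jJ].
have jk : k != j by apply: contraNneq kJ => ->.
have -> : (k |: J :\ l) :\ j = k |: J :\ l :\ j.
  by apply/setP => a; rewrite !inE; case: (eqVneq a k) => [->|]; rewrite ?jk.
rewrite -scalerAr scalerA mulrA -exprD -/(G l j); congr (_ *: _); rewrite /e.
have jl' : (j < l)%N || (l < j)%N by rewrite -neq_ltn.
case: (ltnP k j) => kj /=.
  rewrite cntU1 // kj; case: (ltnP j l) jl' => lj /= jl'; last first.
    rewrite !mul0r subr0 (@cntD_out _ J j) ?(@cntD_lt _ J l 0 j) //.
      by congr (_ ^+ _); clear -lj kj; lia.
    by clear -lj kj; lia.
  rewrite mul1r (@cntD_out _ J l 0 j) ?(@cntD_lt _ J j k.+1 l) //; last by clear -lj; lia.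
  (* With E = [e j l], the coefficient is t^E - lam t^(E+1) = t^(E+2), again by 1 - t lam = t^2. *)
  have -> : (cnt J 0 l + cnt (J :\ l) k.+1 j)%N = (cnt J 0 j + (cnt (J :\ j) k.+1 l)).+1.
    rewrite cntD_out; last by clear -lj; lia.
    have := @cnt_split _ J 0 j l; have := @cnt_split _ J k.+1 j l.
    by rewrite (cntD_lt jJ kj lj) => /(_ _) h1 /(_ _) h2; clear -h1 h2 lj kj; lia.
  by rewrite addSn addnS !exprS addnC; field.
rewrite !mul0r subr0; congr (_ ^+ _).
have lt_jk : (j < k)%N by rewrite ltn_neqAle kj eq_sym jk.
by rewrite cntU_out ?(@cntD_out _ J j) ?(@cntD_out _ J l); clear -lt_jk kl kj; lia.
Qed.
End QuantumMinors.

(** * Passing a power of one entry of row i: the vertex rules *)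

Section Steps.
Context (K : fieldType) (q : K) (q_neq0 : q != 0) (n : nat) (R : algType K).
Context (Z : 'I_n -> 'I_n -> R) (qZ : qmatrix q Z).

Local Notation t := (- q ^+ 2).
Local Notation lam := (q ^+ 2 - q ^- 2).
Local Notation prow := (prow q Z).
Local Notation minor := (minor q Z).
Local Notation commrow := (commrow q Z).

Implicit Types (J : {set 'I_n}) (F : {set 'I_n} -> R).

(* These normalizations make the coefficients of the four rules step0_out, step0_in,
   step1_in and step1_out polynomials in q. *)
Definition low (i j : 'I_n) a : R := q ^+ (a * a.+1) *: Z i j ^+ a.
Definition up (i j : 'I_n) a : R := q ^+ (a * a.-1) *: Z i j ^+ a.

Lemma qcommXr c (x y : R) a : y * x = c *: (x * y) -> y * x ^+ a = c ^+ a *: (x ^+ a * y).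
Proof.
move=> yx; elim: a => [|a IH]; first by rewrite !expr0 scale1r mulr1 mul1r.
rewrite exprS mulrA yx -scalerAl -(mulrA x y) IH -scalerAr scalerA -exprS mulrA.
by [].
Qed.

Section OneRow.
Context (i k : 'I_n) (F : {set 'I_n} -> R) (FE : commrow i F).

Lemma commrow_in J : k \in J -> F J * Z i k = q ^- 2 *: (Z i k * F J).
Proof. by move=> kJ; rewrite FE kJ. Qed.

(** The corrections from [commrow] add up to an expansion in which row i occurs twice, which is 0 by
    [prow_prow]. *)
Lemma prowS_out J : k \notin J ->
  prow k.+1 i F J * Z i k = q ^- 2 *: (Z i k * prow k.+1 i F J).
Proof.
move=> kJ; have := prow_prow q_neq0 qZ k.+1 i F (k |: J).
rewrite /prow big_mkcondr big_setU1 //= ltnn add0r -big_mkcondr /=.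
rewrite -/prow => h0; rewrite mulr_suml mulr_sumr scaler_sumr.
apply/eqP; rewrite -subr_eq0 -sumrB; apply/eqP.
transitivity (- lam *: 0 : R); last by rewrite scaler0.
rewrite -[in RHS]h0 scaler_sumr; apply: eq_bigr => j /andP[jJ kj].
have jk : k != j by rewrite -val_eqE /= neq_ltn kj.
have -> : (k |: J) :\ j = k |: J :\ j.
  by apply/setP => a; rewrite !inE; case: (eqVneq a k) => [->|]; rewrite ?jk.
rewrite -scalerAl -mulrA FE in_setD1 (negPf kJ) andbF mulrBr mulrA (ZrowV q_neq0 qZ _ kj).
rewrite cntU_out ?ltnn // scalerBr -!scalerAr -!scalerAl !scalerA mulrA.
by rewrite addrAC [q ^- 2 * _]mulrC subrr add0r mulNr scaleNr [lam * _]mulrC.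
Qed.

(** One q^-2 comes from the entry of row i, the other from the minor, which still contains column
    k. *)
Lemma prowS_in J : k \in J ->
  prow k.+1 i F J * Z i k = q ^- 4 *: (Z i k * prow k.+1 i F J).
Proof.
move=> kJ; rewrite /prow mulr_suml mulr_sumr scaler_sumr.
apply: eq_bigr => j /andP[jJ kj].
have jk : k != j by rewrite -val_eqE /= neq_ltn kj.
rewrite -scalerAl -mulrA FE in_setD1 jk kJ /= -scalerAr mulrA (ZrowV q_neq0 qZ _ kj).
rewrite -scalerAl -scalerAr !scalerA mulrA; congr (_ *: _).
by field.
Qed.

(** The correction from [F (J :\ k)] is absorbed by the remaining columns: t q^-4 - lam = t. *)
Lemma prow_comm J : k \in J -> prow k i F J * Z i k = Z i k * prow k i F J.
Proof.
move=> kJ; rewrite prow_in // mulrDl -scalerAl prowS_in // -(mulrA (Z i k) (F _)) FE !inE eqxx /=.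
rewrite setD1K // mulrBr mulrDr -scalerAr -addrA -!scalerAr; congr (_ + _).
by rewrite scalerA -scaleNr -scalerDl; congr (_ *: _); field.
Qed.

(** The corrections form a geometric sum of ratio q^-4, and lam = q^2 (1 - q^-4). *)
Lemma commrow_outX J a : k \notin J -> F J * Z i k ^+ a =
  Z i k ^+ a * F J - (q ^+ 2 * (1 - (q ^- 4) ^+ a)) *: (Z i k ^+ a.-1 * prow k.+1 i F (k |: J)).
Proof.
move=> kJ; elim: a => [|a IH].
  by rewrite !expr0 subrr mulr0 scale0r subr0 mulr1 mul1r.
rewrite exprSr mulrA IH mulrBl -(mulrA _ (F J)) FE (negPf kJ) mulrBr mulrA -exprSr.
rewrite -scalerAr -scalerAl -(mulrA _ (prow _ _ _ _)) prowS_in ?setU11 //.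
rewrite -scalerAr scalerA mulrA /=.
rewrite -addrA -opprD; congr (_ - _).
case: a {IH} => [|a /=].
  by rewrite subrr mulr0 mul0r scale0r addr0 expr0 expr1; congr (_ *: _); field.
by rewrite -exprSr -scalerDl; congr (_ *: _); rewrite !exprS; field.
Qed.

Lemma exp_up_low a : (a * a.+1 = a * a.-1 + a.*2)%N.
Proof. by case: a => //= a; nia. Qed.

Lemma q_double_cancel a : q ^+ a.*2 * (q ^- 2) ^+ a = 1.
Proof. by rewrite -mul2n exprM -exprMn mulfV ?expr1n ?expf_neq0. Qed.

(** In the four rules, [prow k i F J] is the state in which row i still owes an entry and [F J] the
    one in which it does not; k in J means that column k is still owed. *)
Lemma step0_out J a : k \notin J ->
  prow k i F J * low i k a = up i k a * prow k.+1 i F J.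
Proof.
move=> kJ; rewrite prow_notin // /low /up -scalerAr (qcommXr a (prowS_out kJ)).
rewrite scalerA -scalerAl exp_up_low exprD -mulrA; congr (_ *: _).
by rewrite q_double_cancel mulr1.
Qed.

(** Either Z_ik pays for both row i and column k, or both debts are carried on at the price of
    q^(2a+2). *)
Lemma step0_in J a : k \in J ->
  prow k i F J * low i k a =
    up i k a.+1 * F (J :\ k) - q ^+ (a.*2 + 2) *: (up i k a * prow k.+1 i F J).
Proof.
move=> kJ; rewrite /low /up -scalerAr.
have := @qcommXr 1 (Z i k) (prow k i F J) a; rewrite scale1r => -> //; last exact: prow_comm.
rewrite expr1n scale1r prow_in // mulrDr mulrA -exprSr scalerDr -!scalerAl.
rewrite [(a.+1 * _)%N]mulnC /=; congr (_ + _).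
rewrite -scalerAr !scalerA -scaleNr; congr (_ *: _).
by rewrite exp_up_low !exprD; ring.
Qed.

Lemma step1_in J a : k \in J -> F J * low i k a = up i k a * F J.
Proof.
move=> kJ; rewrite /low /up -scalerAr (qcommXr a (commrow_in kJ)).
rewrite scalerA -scalerAl exp_up_low exprD -mulrA; congr (_ *: _).
by rewrite q_double_cancel mulr1.
Qed.

(** The power of Z_ik may give up one factor, after which row i and column k are owed. For a = 0
    that coefficient vanishes, so the default [a.-1] = 0 is harmless. *)
Lemma step1_out J a : k \notin J ->
  F J * low i k a = q ^+ a.*2 *: (up i k a * F J) +
    (1 - q ^+ (4 * a)) *: (up i k a.-1 * prow k.+1 i F (k |: J)).
Proof.
move=> kJ; rewrite /low /up -scalerAr commrow_outX // scalerBr -!scalerAl !scalerA.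
congr (_ *: _ + _); first by rewrite exp_up_low addnC exprD.
rewrite -scaleNr; congr (_ *: _).
rewrite exprVn -exprM.
case: a => [|a]; first by rewrite muln0 !expr0 invr1 subrr !(mulr0, mul0r) oppr0.
have -> : (a.+1 * a.+2 = a.+1.-1 * a.+1.-1.-1 + 4 * a + 2)%N.
  by case: a => //= a; nia.
rewrite mulnS !exprD; field.
by rewrite q_neq0 expf_neq0.
Qed.

(** This is the form that bar produces: it reverses products and inverts t. *)
Lemma prow_right J : prow 0 i F J =
  \sum_(j in J) (t ^+ cnt J 0 j)^-1 *: (F (J :\ j) * Z i j).
Proof.
pose g (j l : 'I_n) : R := (lam * (t ^+ cnt J 0 j)^-1 * t ^+ cnt J j.+1 l) *:
  (Z i l * F (J :\ l)).
transitivity (\sum_(j in J) ((t ^+ cnt J 0 j)^-1 *: (Z i j * F (J :\ j)) -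
   \sum_(l in J | (j < l)%N) g j l)); last first.
  apply: eq_bigr => j jJ; rewrite FE !inE eqxx /= setD1K // scalerBr; congr (_ - _).
  rewrite scalerA scaler_sumr; apply: eq_bigr => l _; rewrite scalerA; congr (_ *: _).
  by ring.
rewrite sumrB (exchange_big_dep (mem J)) /=; last by move=> ? ? _ /andP[].
rewrite -sumrB prow0E; apply: eq_bigr => l lJ; rewrite /g -scaler_suml -scalerBl.
congr (_ *: _).
have t0 := t_neq0 q_neq0.
(* The sum telescopes, because lam / t = t^-2 - 1. *)
have main : forall m : nat, (m <= n)%N ->
    \sum_(j in J | (j < m)%N) (lam / t * (t ^+ cnt J 0 j)^-1 ^+ 2) =
    (t ^+ cnt J 0 m)^-1 ^+ 2 - 1.
  elim=> [_|m IH mn]; first by rewrite cnt0 // expr0 invr1 expr1n subrr big1 // => j /andP[].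
  pose k' := Ordinal mn.
  rewrite (bigID (fun j : 'I_n => j < m)%N) /=.
  rewrite (eq_bigl (fun j => (j \in J) && (j < m)%N)) ?IH 1?ltnW //; last first.
    by move=> j; case: (j \in J) => //=; lia.
  rewrite (@cnt0_lt _ J k' m.+1) //= (@cnt0 _ J m.+1 m.+1) // addn0.
  rewrite (eq_bigl (fun j => (j \in J) && (j == k'))); last first.
    by move=> j; case: (j \in J) => //=; rewrite -val_eqE /=; lia.
  case: (boolP (k' \in J)) => mJ; last first.
    rewrite big1 ?addr0 ?addn0 // => j /andP[jJ /eqP jk].
    by rewrite jk (negPf mJ) in jJ.
  rewrite (big_pred1 k') /=; last first.
    by move=> j /=; case: eqP => [->|]; rewrite ?mJ ?andbF.
  have cm0 : t ^+ cnt J 0 m != 0 by rewrite expf_neq0.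
  move: cm0; rewrite exprD expr1; move: (t ^+ _) => c c0.
  by field; rewrite q_neq0 c0 t0.
have cl0 : t ^+ cnt J 0 l != 0 by rewrite expf_neq0.
apply/eqP; rewrite eq_sym subr_eq addrC -subr_eq; apply/eqP.
transitivity (t ^+ cnt J 0 l * ((t ^+ cnt J 0 l)^-1 ^+ 2 - 1)).
  by move: cl0; move: (t ^+ _) => c c0; field.
rewrite -main 1?ltnW // mulr_sumr.
rewrite [RHS](eq_bigl (fun j => (j \in J) && (j < l)%N)); last first.
  by move=> j; rewrite lJ.
apply: eq_bigr => j /andP[jJ jl].
have cj0 : t ^+ cnt J 0 j != 0 by rewrite expf_neq0.
rewrite (cnt0_lt J jl) jJ !exprD expr1.
move: cj0; move: (t ^+ _) => c c0; move: (t ^+ _) => d.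
by field; rewrite ?q_neq0 ?c0 ?t0.
Qed.

End OneRow.
End Steps.

(** * Centrality of the full minor, and its expansion over permutations *)

Section Determinant.
Context (K : fieldType) (q : K) (q_neq0 : q != 0) (n : nat) (R : algType K).
Context (Z : 'I_n -> 'I_n -> R) (qZ : qmatrix q Z).

Local Notation t := (- q ^+ 2).
Local Notation prow := (prow q Z).
Local Notation minor := (minor q Z).
Local Notation commrow := (commrow q Z).

Implicit Types (J : {set 'I_n}) (F : {set 'I_n} -> R) (w : seq 'I_n).

Definition ltI (i j : 'I_n) := (i < j)%N.

Lemma index_enum_ord m : index_enum 'I_m = enum 'I_m.
Proof. by rewrite enumT [index_enum _]unlock. Qed.

Lemma enum_pairwise : pairwise ltI (enum 'I_n).
Proof.
rewrite -(pairwise_map val ltn) val_enum_ord.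
by rewrite -sorted_pairwise ?iota_ltn_sorted //; apply: ltn_trans.
Qed.

Lemma commrow_minor i w : all (ltI i) w -> commrow i (minor w).
Proof.
elim: w => [_|s w IH /andP[is_ iw]]; first exact: commrow_nil.
exact: commrow_prow (IH iw).
Qed.

(* The Laplace expansion along column k of the minor with rows w and columns k |: J,
   up to a power of t, with the entries of column k on the right. *)
Fixpoint colsum (k : 'I_n) w J : R :=
  if w is i :: w' then minor w' J * Z i k + t^-1 *: prow 0 i (colsum k w') J else 0.

(** Moving the entry of column k to the left, the case k in J cancels by q^-2 + t^-1 = 0; otherwise
    t^-1 - lam = t corrects the exponents of the columns beyond k. *)
Lemma colsumE k w J : pairwise ltI w ->
  colsum k w J = if k \in J then 0 else (t ^+ cnt J 0 k)^-1 *: minor w (k |: J).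
Proof.
have t0 := t_neq0 q_neq0.
elim: w J => [|i w IH] J.
  move=> _; case: ifP => //= _; rewrite (_ : _ == set0 = false) ?scaler0 //.
  by apply/negbTE/set0Pn; exists k; rewrite setU11.
rewrite pairwise_cons => /andP[iw pw] /=; rewrite commrow_minor //.
have {}IH J' := IH J' pw.
rewrite prow0E; under eq_bigr => j _ do rewrite IH.
case: ifPn => kJ.
  rewrite (bigD1 k) //= big1 ?addr0 => [|j /andP[jJ jk]]; last first.
    by rewrite !inE eq_sym jk kJ mulr0 scaler0.
  rewrite !inE eqxx /= setD1K // -scalerAr !scalerA cntD_out ?ltnn ?andbF //.
  rewrite -scalerDl [X in X *: _](_ : _ = 0) ?scale0r //.
  have c0 : t ^+ cnt J 0 k != 0 by rewrite expf_neq0.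
  by move: c0; move: (t ^+ _) => c c0; field; rewrite q_neq0 c0 t0.
rewrite prow0E big_setU1 //= scalerDr setU1K // cntU_out ?ltnn ?andbF //.
rewrite scalerA mulVf ?expf_neq0 // scale1r -addrA; congr (_ + _).
rewrite /prow [X in - (_ *: X)]big_mkcondr big_setU1 //= ltnn add0r.
rewrite !scaler_sumr -sumrN -big_split; apply: eq_bigr => j jJ /=.
have jk : k != j by apply: contraNneq kJ => ->.
have -> : (k |: J) :\ j = k |: J :\ j.
  by apply/setP => a; rewrite !inE; case: (eqVneq a k) => [->|]; rewrite ?jk.
rewrite !inE (negPf kJ) andbF -scalerAr !scalerA.
have c0 : t ^+ cnt (J :\ j) 0 k != 0 by rewrite expf_neq0.
case: ltnP => kj.
  rewrite (@cntU_out _ J k k.+1 j) ?ltnn // (@cntU1 _ J k 0 j) // kj.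
  rewrite scalerA -scaleNr -scalerDl; congr (_ *: _).
  rewrite (cnt0_lt J kj) (negPf kJ) (@cntD_out _ J j) ?(ltnNge j) ?(ltnW kj) ?andbF //.
  rewrite cntD_out in c0; last by rewrite (ltnNge j) (ltnW kj) andbF.
  move: c0; rewrite /= !add0n !exprD expr1; move: (t ^+ _) => c c0; move: (t ^+ _) => d.
  by field; rewrite ?q_neq0 ?c0 ?t0.
have lt_jk : (j < k)%N by rewrite ltn_neqAle kj eq_sym jk.
rewrite scaler0 oppr0 add0r; congr (_ *: _).
rewrite cntU_out; last by rewrite ltnNge kj andbF.
rewrite (@cntD_lt _ J j 0 k) // (exprS t).
by move: c0; move: (t ^+ _) => c c0; move: (t ^+ _) => d; field; rewrite ?q_neq0 ?c0 ?t0.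
Qed.

(** Exchanges by [prowC] bring i next to its other occurrence, where [prow_prow] applies. *)
Lemma prow_minor_mem i w J : pairwise ltI w -> i \in w -> prow 0 i (minor w) J = 0.
Proof.
elim: w J => // r w IH J; rewrite pairwise_cons => /andP[rw pw].
rewrite inE => /orP[/eqP->|iw]; first exact: prow_prow.
rewrite /= (prowC q_neq0 qZ 0 _ J (allP rw _ iw)).
rewrite [X in _ *: X](_ : _ = prow 0 r (fun=> 0) J); first by rewrite prow0 scaler0.
by apply: eq_prow => J'; apply: IH.
Qed.

(** Row i occurs twice in every term except the one whose column entry is Z_ik. The t^-1 in [colsum]
    offsets the factor t of each row exchange. *)
Lemma prow_colsum i k w J : pairwise ltI w -> i \in w ->
  prow 0 i (colsum k w) J = minor w J * Z i k.
Proof.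
elim: w J => // r w IH J; rewrite pairwise_cons => /andP[rw pw] irw /=.
rewrite prowD prowZ prowMr; move: irw; rewrite inE => /orP[/eqP->|iw].
  by rewrite prow_prow // scaler0 addr0.
rewrite prow_minor_mem // mul0r add0r (prowC q_neq0 qZ 0 _ J (allP rw _ iw)).
rewrite scalerA mulVf ?scale1r ?t_neq0 //.
by rewrite -prowMr; apply: eq_prow => J'; apply: IH.
Qed.

(** Row i prefixed to the expansion along column k gives the left side by [prow_colsum]; by
    [colsumE] only j = k survives, which gives the right side. *)
Lemma minor_setT_comm i k :
  minor (enum 'I_n) setT * Z i k = Z i k * minor (enum 'I_n) setT.
Proof.
rewrite -(@prow_colsum i) ?enum_pairwise ?mem_enum // prow0E (bigD1 k (in_setT k)) /=.
rewrite big1 ?addr0 => [|j /andP[_ jk]]; last first.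
  by rewrite colsumE ?enum_pairwise // !inE eq_sym jk /= mulr0 scaler0.
rewrite colsumE ?enum_pairwise // !inE eqxx /= (setD1K (in_setT k)) cntD_out ?ltnn ?andbF //.
by rewrite -scalerAr scalerA mulfV ?scale1r // expf_neq0 // t_neq0.
Qed.

Fixpoint inv (u : seq 'I_n) : nat :=
  if u is j :: u' then (count (fun m : 'I_n => (m < j)%N) u' + inv u')%N else 0%N.

(** The first letter j contributes [cnt J 0 j], which counts its inversions because the later
    letters fill [J :\ j]. *)
Lemma minor_tuples m w J : size w = m -> minor w J =
  \sum_(u : m.-tuple 'I_n | uniq u && ([set x in u] == J))
     t ^+ inv u *: \prod_(p <- zip w u) Z p.1 p.2.
Proof.
elim: m w J => [|m IH] [|i w] J //=.
  move=> _; rewrite (eq_bigl (fun=> set0 == J)); last first.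
    by move=> u; rewrite tuple0 /=; congr (_ == _); apply/setP=> x; rewrite !inE.
  rewrite eq_sym; case: eqP => _; last by rewrite big_pred0.
  rewrite (big_pred1 [tuple]) => [|u]; last by rewrite [u]tuple0 /= eqxx.
  by rewrite big_nil expr0 scale1r.
case=> sw; rewrite (reindex (fun p : 'I_n * m.-tuple 'I_n => cons_tuple p.1 p.2)) /=; last first.
  exists (fun u => (thead u, [tuple of behead u])) => [[j u] _|u _] /=.
    by congr (_, _); apply: val_inj.
  by rewrite [RHS]tuple_eta; apply: val_inj.
transitivity (\sum_(j : 'I_n)
    \sum_(u : m.-tuple 'I_n | [&& j \notin tval u, uniq u & [set x in j :: u] == J])
    t ^+ inv (j :: u) *: \prod_(p <- zip (i :: w) (j :: u)) Z p.1 p.2); last first.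
  by rewrite pair_big_dep /=; apply: eq_bigl => -[j u] /=; rewrite andbA.
rewrite prow0E big_mkcond; apply: eq_bigr => j _.
case: ifPn => jJ; last first.
  rewrite big1 // => u /and3P[_ _ /eqP uJ]; case/negP: jJ; by rewrite -uJ inE mem_head.
rewrite (IH w _ sw) mulr_sumr scaler_sumr; apply: eq_big => [u|u /andP[uu /eqP uJ]].
  apply/andP/and3P => [[uu /eqP uJ]|[ju uu /eqP uJ]].
    have ju : j \notin tval u.
      by have := setD11 j J; rewrite -uJ inE => ->.
    by split => //; rewrite set_cons uJ setD1K.
  split => //; rewrite -uJ set_cons setU1K // inE; exact: ju.
rewrite big_cons /= -scalerAr scalerA -exprD; congr (_ ^+ (_ + _) *: _).
rewrite -(@cntD_out _ J j) ?ltnn ?andbF // /cnt -uJ -sum1_count.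
rewrite [RHS]big_mkcond /= [RHS]big_uniq //=.
by apply: eq_big => [x|x _]; rewrite ?inE //; case: ltnP.
Qed.

Lemma inv_map (f : 'I_n -> 'I_n) w : pairwise ltI w ->
  inv (map f w) = (\sum_(i <- w) \sum_(j <- w | i < j) (f j < f i))%N.
Proof.
elim: w => [|r w IH]; first by rewrite big_nil.
rewrite pairwise_cons /= big_cons => /andP[rw pw]; rewrite IH // big_cons ltnn.
congr (_ + _)%N.
  rewrite count_map -sum1_count big_mkcond /= [RHS]big_seq_cond [LHS]big_seq.
  apply: eq_big => [i|i iw]; last by case: ltnP.
  by case: (boolP (i \in w)) => //= iw; rewrite [(r < i)%N](allP rw i iw).
rewrite [LHS]big_seq [RHS]big_seq; apply: eq_bigr => i iw; rewrite big_cons.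
by have ri : (r < i)%N := allP rw i iw; rewrite ltnNge ltnW.
Qed.

Lemma minor_det : minor (enum 'I_n) setT =
  \sum_(s : 'S_n) t ^+ perm_length s *: \prod_(i < n) Z i (s i).
Proof.
rewrite (minor_tuples (m := n)) ?size_enum_ord //.
rewrite (eq_bigl (fun u : n.-tuple 'I_n => uniq u)); last first.
  move=> u; case: (boolP (uniq u)) => //= uu; apply/eqP/setP => x; rewrite !inE.
  have sz : (size (enum 'I_n) <= size u)%N by rewrite size_enum_ord size_tuple.
  have [_ /(_ x)] := uniq_min_size uu (fun y _ => mem_enum 'I_n y) sz.
  by rewrite mem_enum.
rewrite (reindex (fun s : 'S_n => [tuple of map s (ord_tuple n)])) /=; last first.
  (* The default permutation is never returned: the letters of u are distinct. *)
  exists (fun u : n.-tuple 'I_n => insubd (1%g : 'S_n) [ffun i => tnth u i]) => [s _|u].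
    apply: val_inj; rewrite /= val_insubd.
    rewrite [X in if X then _ else _](_ : _ = true).
      by apply/ffunP => i; rewrite ffunE tnth_map tnth_ord_tuple pvalE.
    by apply/injectiveP => i j; rewrite !ffunE !tnth_map !tnth_ord_tuple => /perm_inj.
  rewrite inE => uu; apply: eq_from_tnth => i; rewrite tnth_map tnth_ord_tuple.
  rewrite -pvalE val_insubd [X in if X then _ else _](_ : _ = true) ?ffunE //.
  by apply/injectiveP => a b; rewrite !ffunE => /(tuple_uniqP _ uu).
apply: eq_big => [s|s _].
  by rewrite map_inj_uniq ?enum_uniq //; apply: perm_inj.
rewrite inv_map ?enum_pairwise //; congr (_ ^+ _ *: _).
  rewrite /perm_length -sum1_card big_enum /=.
  rewrite (eq_bigr (fun i : 'I_n => (\sum_(j : 'I_n | (i < j) && (s j < s i)) 1)%N)); last first.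
    by move=> i _; rewrite big_enum_cond /= [RHS]big_mkcondr; apply: eq_bigr => j _; case: ltnP.
  by rewrite pair_big_dep /=; apply: eq_bigl => p; rewrite inE.
transitivity (\prod_(i <- enum 'I_n) Z i (s i)); last by rewrite -index_enum_ord.
elim: (enum 'I_n) => [|i w IH] /=; first by rewrite !big_nil.
by rewrite !big_cons IH.
Qed.

End Determinant.

Section IntegralPolynomials.
Context (K : fieldType) (q : K).

Lemma ofZq_is_zmod_morphism : zmod_morphism (ofZq q).
Proof. by move=> x y; rewrite /ofZq rmorphB hornerD hornerN. Qed.

Lemma ofZq_is_monoid_morphism : monoid_morphism (ofZq q).
Proof.
by split=> [|x y]; rewrite /ofZq ?rmorph1 ?hornerC // rmorphM hornerM.
Qed.

HB.instance Definition _ :=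
  GRing.isZmodMorphism.Build {poly int} K (ofZq q) ofZq_is_zmod_morphism.
HB.instance Definition _ :=
  GRing.isMonoidMorphism.Build {poly int} K (ofZq q) ofZq_is_monoid_morphism.

Lemma ofZqX : ofZq q 'X = q.
Proof. by rewrite /ofZq map_polyX hornerX. Qed.

Lemma ofZqXn m : ofZq q 'X^m = q ^+ m.
Proof. by rewrite rmorphXn /= ofZqX. Qed.

End IntegralPolynomials.

(** * Integrality: moving the minor through the whole monomial *)

Section Expansion.
Context (K : fieldType) (q : K) (q_neq0 : q != 0) (n : nat) (R : algType K).
Context (Z : 'I_n -> 'I_n -> R) (qZ : qmatrix q Z).

Local Notation prow := (prow q Z).
Local Notation minor := (minor q Z).
Local Notation low := (low q Z).
Local Notation up := (up q Z).

Implicit Types (J : {set 'I_n}) (A C : 'M[nat]_n).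

(** Presented by generation rather than by coefficients, since the induction only transports
    generators. *)
Inductive span (P : 'M[nat]_n -> Prop) (f : 'M[nat]_n -> R) : R -> Prop :=
| span0 : span P f 0
| spanD x y of span P f x & span P f y : span P f (x + y)
| span_gen p C of P C : span P f (ofZq q p *: f C).

Lemma span_mem (P : 'M[nat]_n -> Prop) f C : P C -> span P f (f C).
Proof. by move=> PC; rewrite -[f C]scale1r -(rmorph1 (ofZq q)); apply: span_gen. Qed.

Lemma spanZ P f p x : span P f x -> span P f (ofZq q p *: x).
Proof.
elim=> [|y z _ IHy _ IHz|r C PC]; first by rewrite scaler0; apply: span0.
  by rewrite scalerDr; apply: spanD.
by rewrite scalerA -rmorphM; apply: span_gen.
Qed.

Lemma span_mull (P P' : 'M[nat]_n -> Prop) f f' x y :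
  (forall C, P C -> P' C /\ x * f C = f' C) -> span P f y -> span P' f' (x * y).
Proof.
move=> sub; elim=> [|z z' _ IHz _ IHz'|r C PC]; first by rewrite mulr0; apply: span0.
  by rewrite mulrDr; apply: spanD.
by have [P'C xf] := sub C PC; rewrite -scalerAr xf; apply: span_gen.
Qed.

Lemma span_unscale (P P' : 'M[nat]_n -> Prop) f f' a x :
  (forall C, P C -> P' C /\ f C = a *: f' C) -> span P f x ->
  exists2 y, span P' f' y & x = a *: y.
Proof.
move=> sub; elim=> [|y z _ [y' sy ->] _ [z' sz ->]|r C PC].
- by exists 0; [apply: span0 | rewrite scaler0].
- by exists (y' + z'); [apply: spanD | rewrite scalerDr].
have [P'C ->] := sub C PC; exists (ofZq q r *: f' C); first exact: span_gen.
by rewrite !scalerA mulrC.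
Qed.

Definition rtail (g : 'I_n -> 'I_n -> nat -> R) (i : nat) A : R :=
  \prod_(r <- drop i (enum 'I_n)) \prod_(j <- enum 'I_n) g r j (A r j).

(** With [low] it is the suffix of the monomial still to be crossed, with [up] the suffix that
    replaces it. *)
Definition ltail (g : 'I_n -> 'I_n -> nat -> R) (i : 'I_n) (k : nat) A : R :=
  (\prod_(j <- drop k (enum 'I_n)) g i j (A i j)) * rtail g i.+1 A.

Lemma drop_enum (k : 'I_n) : drop k (enum 'I_n) = k :: drop k.+1 (enum 'I_n).
Proof. by rewrite (drop_nth k) ?size_enum_ord // nth_ord_enum. Qed.

Lemma mem_drop_enum k (j : 'I_n) : (j \in drop k (enum 'I_n)) = (k <= j)%N.
Proof.
rewrite -(mem_map val_inj) map_drop val_enum_ord drop_iota add0n mem_iota /=.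
by have := ltn_ord j; move: (nat_of_ord j) => /= m; lia.
Qed.

Lemma ltailS g (i k : 'I_n) A : ltail g i k A = g i k (A i k) * ltail g i k.+1 A.
Proof. by rewrite /ltail drop_enum big_cons mulrA. Qed.

Lemma rtailE g (i : 'I_n) A : rtail g i A = ltail g i 0 A.
Proof. by rewrite /rtail drop_enum big_cons /ltail drop0. Qed.

Lemma ltail_n g i A : ltail g i n A = rtail g i.+1 A.
Proof. by rewrite /ltail drop_oversize ?size_enum_ord // big_nil mul1r. Qed.

Lemma rtail_n g A : rtail g n A = 1.
Proof. by rewrite /rtail drop_oversize ?size_enum_ord // big_nil. Qed.

Lemma eq_ltail g (i : 'I_n) k A C :
  (forall r j : 'I_n, ((i < r) || (r == i) && (k <= j))%N -> A r j = C r j) ->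
  ltail g i k A = ltail g i k C.
Proof.
move=> AC; congr (_ * _).
  by apply: eq_big_seq => j; rewrite mem_drop_enum => kj; rewrite AC ?eqxx ?kj ?orbT.
apply: eq_big_seq => r; rewrite mem_drop_enum => ir.
by apply: eq_bigr => j _; rewrite AC ?ir.
Qed.

(* The matrices C reached from A when the columns J and the rows from i on still
   have to be used once, row i only if b holds, its columns before k being done. *)
Definition reach (b : bool) (i k : nat) J A C : Prop :=
  [/\ forall r j : 'I_n, ((r < i) || (r == i :> nat) && (j < k))%N -> C r j = A r j,
      forall r, (\sum_j C r j = \sum_j A r j + ((i < r) + ((r == i :> nat) && b)))%N
    & forall j, (\sum_r C r j = \sum_r A r j + (j \in J))%N].

Definition upd A (i k : 'I_n) c : 'M[nat]_n :=
  \matrix_(r, j) if (r == i) && (j == k) then c else A r j.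

Lemma upd_row A (i k : 'I_n) c :
  (\sum_j upd A i k c i j + A i k = \sum_j A i j + c)%N.
Proof.
rewrite (bigD1 k) //= [in RHS](bigD1 k) //= mxE !eqxx /=.
rewrite (eq_bigr (A i)) => [|j /negPf jk]; last by rewrite mxE jk andbF.
by rewrite addnAC [(c + _)%N]addnC addnAC.
Qed.

Lemma upd_col A (i k : 'I_n) c :
  (\sum_r upd A i k c r k + A i k = \sum_r A r k + c)%N.
Proof.
rewrite (bigD1 i) //= [in RHS](bigD1 i) //= mxE !eqxx /=.
rewrite (eq_bigr (A^~ k)) => [|j /negPf jk]; last by rewrite mxE jk.
by rewrite addnAC [(c + _)%N]addnC addnAC.
Qed.

(** The two equations are the conservation laws of a vertex: what enters along the row or the column
    leaves it or changes the exponent. *)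
Lemma reach_upd (b b' : bool) (i k : 'I_n) J J' A C c :
  (c + b' = A i k + b)%N -> (c + (k \in J') = A i k + (k \in J))%N ->
  (forall j, j != k -> (j \in J') = (j \in J)) ->
  reach b' i k.+1 J' (upd A i k c) C -> C i k = c /\ reach b i k J A C.
Proof.
move=> cb cJ JJ' [Cb Cr Cc]; split; first by rewrite Cb ?mxE ?eqxx ?ltnSn ?orbT.
split=> [r j rj|r|j].
- rewrite Cb; last by move: rj; lia.
  rewrite mxE; case: ifP => // /andP[/eqP ri /eqP jk].
  by move: rj; rewrite ri jk !ltnn eqxx.
- have [->|ri] := eqVneq r i.
    have := Cr i; have := upd_row A i k c; rewrite eqxx ltnn /=; lia.
  rewrite Cr; congr (_ + _)%N; last by rewrite val_eqE (negPf ri).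
  by apply: eq_bigr => j _; rewrite mxE (negPf ri).
- have [->|jk] := eqVneq j k.
    have := Cc k; have := upd_col A i k c; lia.
  rewrite Cc JJ' //; congr (_ + _)%N.
  by apply: eq_bigr => r _; rewrite mxE (negPf jk) andbF.
Qed.

Lemma ltail_upd g (i k : 'I_n) A c : ltail g i k.+1 (upd A i k c) = ltail g i k.+1 A.
Proof.
apply: eq_ltail => r j rj; rewrite mxE; case: ifP => // /andP[/eqP ri /eqP jk].
by move: rj; rewrite ri jk !ltnn andbF.
Qed.

Lemma span_step (b b' : bool) (i k : 'I_n) J J' A c Y :
  (c + b' = A i k + b)%N -> (c + (k \in J') = A i k + (k \in J))%N ->
  (forall j, j != k -> (j \in J') = (j \in J)) ->
  (forall A', span (reach b' i k.+1 J' A') (ltail up i k.+1) (Y * ltail low i k.+1 A')) ->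
  span (reach b i k J A) (ltail up i k) (up i k c * Y * ltail low i k.+1 A).
Proof.
move=> cb cJ JJ' /(_ (upd A i k c)); rewrite ltail_upd -mulrA; apply: span_mull => C.
by move=> /(reach_upd cb cJ JJ')[Cc rC]; rewrite ltailS Cc.
Qed.

Lemma commrow_rows (i : 'I_n) : commrow q Z i (minor (drop i.+1 (enum 'I_n))).
Proof.
apply: commrow_minor => //.
by apply/allP => j; rewrite mem_drop_enum.
Qed.

Section OneRow.
Context (i : 'I_n).
Local Notation F := (minor (drop i.+1 (enum 'I_n))).

Let FE : commrow q Z i F := commrow_rows i.

Hypothesis next : forall J A, span (reach true i.+1 0 J A) (rtail up i.+1)
  (F J * rtail low i.+1 A).

Lemma reach_next J A C : reach true i.+1 0 J A C -> reach false i n J A C.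
Proof.
case=> Cb Cr Cc; split=> // [r j rj|r]; last by rewrite Cr andbF andbT addn0; lia.
by apply: Cb; have := ltn_ord j; lia.
Qed.

(** Both states are treated together because [step0_in] and [step1_out] switch between them. *)
Lemma span_row m k : (k + m)%N = n -> forall J A,
  span (reach false i k J A) (ltail up i k) (F J * ltail low i k A) /\
  span (reach true i k J A) (ltail up i k) (prow k i F J * ltail low i k A).
Proof.
elim: m k => [|m IH] k km J A.
  (* At the end of the row an entry still owed gives 0; otherwise the next row takes over. *)
  rewrite addn0 in km; rewrite km; split; last by rewrite prow_nil mul0r; apply: span0.
  rewrite ltail_n -[X in span _ _ X]mul1r; apply: span_mull (next J A) => C rC.
  by rewrite mul1r ltail_n; split=> //; apply: reach_next.
have kn : (k < n)%N by lia.
have {}IH := IH k.+1 (etrans (addSnnS _ _) km).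
rewrite -[k]/(nat_of_ord (Ordinal kn)) in IH *; move: (Ordinal kn) IH => {kn km}k IH.
have mul_ltail X : X * ltail low i k A = X * low i k (A i k) * ltail low i k.+1 A.
  by rewrite ltailS mulrA.
rewrite !mul_ltail; split; case: (boolP (k \in J)) => kJ.
- rewrite step1_in //; apply: (@span_step false false i k J J A (A i k)) => // A'.
  by have [] := IH J A'.
- rewrite step1_out // mulrDl -!(scalerAl _ (up i k _ * _)) -ofZqXn; apply: spanD.
    apply: spanZ; apply: (@span_step false false i k J J A (A i k)) => // A'.
    by have [] := IH J A'.
  have -> : 1 - q ^+ (4 * A i k) = ofZq q (1 - 'X^(4 * A i k)).
    by rewrite rmorphB rmorph1 /= ofZqXn.
  have [->|a0] := posnP (A i k).
    by rewrite muln0 expr0 subrr rmorph0 scale0r; apply: span0.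
  apply: spanZ; apply: (@span_step false true i k J (k |: J) A (A i k).-1) => [|||A'].
  + by rewrite addn1 prednK // addn0.
  + by rewrite setU11 (negPf kJ) addn1 prednK // addn0.
  + by move=> j jk; rewrite !inE (negPf jk).
  + by have [] := IH (k |: J) A'.
- rewrite step0_in // mulrBl -(scalerAl _ (up i k _ * _)); apply: spanD.
    apply: (@span_step true false i k J (J :\ k) A (A i k).+1) => [|||A'].
    + by rewrite addn0 addn1.
    + by rewrite !inE eqxx kJ addn0 addn1.
    + by move=> j jk; rewrite !inE jk.
    + by have [] := IH (J :\ k) A'.
  rewrite -scaleNr -ofZqXn -rmorphN; apply: spanZ.
  apply: (@span_step true true i k J J A (A i k)) => // A'.
  by have [] := IH J A'.
- rewrite step0_out //; apply: (@span_step true true i k J J A (A i k)) => // A'.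
  by have [] := IH J A'.
Qed.

End OneRow.

Lemma span_rows m i : (i + m)%N = n -> forall J A,
  span (reach true i 0 J A) (rtail up i) (minor (drop i (enum 'I_n)) J * rtail low i A).
Proof.
elim: m i => [|m IH] i im J A.
  rewrite addn0 in im; rewrite im drop_oversize ?size_enum_ord // rtail_n mulr1 /=.
  have [->|J0] := eqVneq J set0; last exact: span0.
  rewrite -(rtail_n up A); apply: span_mem.
  split=> // [r|j]; last by rewrite inE addn0.
  by have := ltn_ord r; move: (nat_of_ord r) => r' rn; lia.
have lt_in : (i < n)%N by lia.
have {}IH := IH i.+1 (etrans (addSnnS _ _) im).
rewrite -[i]/(nat_of_ord (Ordinal lt_in)) in IH *; move: (Ordinal lt_in) IH => {lt_in im}i IH.
rewrite drop_enum !rtailE /=; have [_ s] := span_row IH (erefl : (0 + n = n)%N) J A.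
by rewrite -[X in span _ _ X]mul1r; apply: span_mull s => C rC; rewrite mul1r rtailE.
Qed.

(** * The leading term modulo q *)

Definition addI i A : 'M[nat]_n :=
  \matrix_(r, j) (A r j + ((r == j) && (i <= r)))%N.

Definition lead (i : nat) : {set 'I_n} := [set j : 'I_n | (i <= j)%N].

Definition span_lead P (f : 'M[nat]_n -> R) C x :=
  exists2 y, span P f y & x = f C + q *: y.

Lemma addI_upd A (i : 'I_n) : addI i.+1 (upd A i i (A i i).+1) = addI i A.
Proof.
apply/matrixP => r j; rewrite !mxE; have [<-|rj] := eqVneq r j; last first.
  by case: ifP => // /andP[/eqP ri /eqP ji]; rewrite ri ji eqxx in rj.
have [->|ri] := eqVneq r i; first by rewrite ltnn leqnn addn0 addn1.
by rewrite /= ltn_neqAle val_eqE [i == r]eq_sym ri.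
Qed.

Lemma leadD1 (i : 'I_n) : lead i :\ i = lead i.+1.
Proof.
by apply/setP => j; rewrite !inE ltn_neqAle val_eqE [i == j]eq_sym.
Qed.

Lemma span_lead_mull (P P' : 'M[nat]_n -> Prop) f f' C C' x y :
  (forall C, P C -> P' C /\ x * f C = f' C) -> x * f C = f' C' ->
  span_lead P f C y -> span_lead P' f' C' (x * y).
Proof.
move=> sub xC [z sz ->]; exists (x * z); first exact: span_mull sz.
by rewrite mulrDr xC scalerAr.
Qed.

Lemma span_lead_step (b : bool) (i k : 'I_n) (i' : nat) J A Y :
  addI i' A i k = A i k ->
  span_lead (reach b i k.+1 J A) (ltail up i k.+1) (addI i' A) (Y * ltail low i k.+1 A) ->
  span_lead (reach b i k J A) (ltail up i k) (addI i' A)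
    (up i k (A i k) * Y * ltail low i k.+1 A).
Proof.
move=> Aik; rewrite -mulrA; apply: span_lead_mull => [C rC|]; last by rewrite ltailS Aik.
have updA : A = upd A i k (A i k).
  by apply/matrixP => r j; rewrite mxE; case: ifP => // /andP[/eqP-> /eqP->].
rewrite updA in rC; have [Cik rC'] := reach_upd (erefl _) (erefl _) (fun j _ => erefl _) rC.
by split=> //; rewrite ltailS Cik.
Qed.

Section LeadRow.
Context (i : 'I_n).
Local Notation F := (minor (drop i.+1 (enum 'I_n))).

Let FE : commrow q Z i F := commrow_rows i.

Hypothesis next : forall A, span_lead (reach true i.+1 0 (lead i.+1) A) (rtail up i.+1)
  (addI i.+1 A) (F (lead i.+1) * rtail low i.+1 A).

Lemma lead_row1 m k : (k + m)%N = n -> (i < k)%N -> forall A,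
  span_lead (reach false i k (lead i.+1) A) (ltail up i k) (addI i.+1 A)
    (F (lead i.+1) * ltail low i k A).
Proof.
elim: m k => [|m IH] k km ik A.
  rewrite addn0 in km; rewrite km ltail_n -[X in span_lead _ _ _ X]mul1r.
  apply: span_lead_mull (next A) => [C rC|]; last by rewrite mul1r ltail_n.
  by rewrite mul1r ltail_n; split=> //; apply: reach_next.
have kn : (k < n)%N by lia.
have {}IH := IH k.+1 (etrans (addSnnS _ _) km) (ltnW ik).
rewrite -[k]/(nat_of_ord (Ordinal kn)) in ik IH *.
move: (Ordinal kn) ik IH => {kn km}k ik IH.
rewrite ltailS mulrA step1_in ?inE //; apply: span_lead_step; last exact: IH.
rewrite mxE; case: eqP => [<-|]; rewrite ?ltnn addn0 //.
Qed.

Lemma lead_row0 m k : (k + m)%N = n -> (k <= i)%N -> forall A,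
  span_lead (reach true i k (lead i) A) (ltail up i k) (addI i A)
    (prow k i F (lead i) * ltail low i k A).
Proof.
elim: m k => [|m IH] k km ki A.
  by have := ltn_ord i; lia.
have kn : (k < n)%N by lia.
have {}IH := IH k.+1 (etrans (addSnnS _ _) km).
have row1 := @lead_row1 m k.+1 (etrans (addSnnS _ _) km).
have row : forall J A', span (reach true i k.+1 J A') (ltail up i k.+1)
    (prow k.+1 i F J * ltail low i k.+1 A').
  move=> J A'.
  by have [] := span_row (span_rows (subnKC (ltn_ord i))) (etrans (addSnnS k m) km) J A'.
rewrite -[k]/(nat_of_ord (Ordinal kn)) in ki row row1 IH *.
move: (Ordinal kn) ki row row1 IH => {kn km}k ki row row1 IH.
have [ik|ik] := eqVneq k i; last first.
  have lt_ki : (k < i)%N by rewrite ltn_neqAle ki andbT.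
  rewrite ltailS mulrA step0_out ?inE -?ltnNge //.
  apply: span_lead_step; last exact: IH.
  by rewrite mxE eq_sym (negPf ik) addn0.
subst k; rewrite ltailS mulrA step0_in ?inE // mulrBl leadD1 -(scalerAl _ (up i i _ * _)).
have [y sy Ey] := row1 (leqnn _) (upd A i i (A i i).+1).
have sz : span (reach true i i (lead i) A) (ltail up i i)
    (up i i (A i i) * prow i.+1 i F (lead i) * ltail low i i.+1 A).
  by apply: (@span_step true true i i (lead i) (lead i) A (A i i)).
(* The exponent 2a + 1 is the 2a + 2 of [step0_in] with one q taken out; [y] is the remainder on the
   branch that takes Z_ii. *)
exists (up i i (A i i).+1 * y + ofZq q (- 'X^((A i i).*2 + 1)) *:
    (up i i (A i i) * prow i.+1 i F (lead i) * ltail low i i.+1 A)).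
  apply: spanD; last exact: spanZ.
  apply: span_mull sy => C rC.
  have [||j ji|Ci rC'] := @reach_upd true false i i (lead i) (lead i.+1) A C (A i i).+1 _ _ _ rC.
  - by rewrite addn0 addn1.
  - by rewrite !inE leqnn ltnn addn0 addn1.
  - by rewrite -leadD1 !inE ji.
  - by rewrite ltailS Ci.
rewrite ltail_upd in Ey; rewrite -(mulrA _ (F (lead i.+1))) Ey.
rewrite addI_upd mulrDr [in RHS]ltailS mxE eqxx leqnn /= addn1 -addrA; congr (_ + _).
rewrite scalerDr -(scalerAr q (up _ _ _) y) scalerA rmorphN /= ofZqXn mulrN -exprS addnS.
by rewrite scaleNr.
Qed.

End LeadRow.

Lemma span_lead_rows m i : (i + m)%N = n -> forall A,
  span_lead (reach true i 0 (lead i) A) (rtail up i) (addI i A)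
    (minor (drop i (enum 'I_n)) (lead i) * rtail low i A).
Proof.
elim: m i => [|m IH] i im A.
  rewrite addn0 in im; rewrite im drop_oversize ?size_enum_ord // !rtail_n mulr1 /=.
  exists 0; first exact: span0.
  rewrite scaler0 addr0 rtail_n (_ : _ == set0) //.
  by apply/eqP/setP => j; rewrite !inE leqNgt ltn_ord.
have lt_in : (i < n)%N by lia.
have {}IH := IH i.+1 (etrans (addSnnS _ _) im).
rewrite -[i]/(nat_of_ord (Ordinal lt_in)) in IH *; move: (Ordinal lt_in) IH => {lt_in im}i IH.
rewrite drop_enum !rtailE /=.
have s := lead_row0 IH (erefl : (0 + n = n)%N) (leq0n _) A.
rewrite -[X in span_lead _ _ _ X]mul1r.
by apply: span_lead_mull s => [C rC|]; rewrite mul1r rtailE.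
Qed.

End Expansion.

(** * The exponent of D in terms of row and column sums *)

Section Exponents.
Context (n : nat).
Implicit Types A C : 'M[nat]_n.

Lemma sqr_sum (f : 'I_n -> nat) :
  ((\sum_i f i) ^ 2 = \sum_i f i ^ 2 + 2 * \sum_(j < n) \sum_(k < n | k < j) f j * f k)%N.
Proof.
have -> : ((\sum_i f i) ^ 2 = \sum_j \sum_k f j * f k)%N.
  rewrite expnS expn1 big_distrl; apply: eq_bigr => j _ /=.
  by rewrite big_distrr.
have split_row (j : 'I_n) : (\sum_k f j * f k = f j ^ 2 + (\sum_(k < n | k < j) f j * f k +
    \sum_(k < n | j < k) f j * f k))%N.
  rewrite (bigD1 j) //= mulnn; congr (_ + _)%N.
  rewrite (bigID (fun k : 'I_n => k < j)%N) /=; congr (_ + _)%N.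
    by apply: eq_bigl => k; rewrite -val_eqE /=; lia.
  by apply: eq_bigl => k; rewrite -val_eqE /=; lia.
under eq_bigr => j _ do rewrite split_row.
rewrite !big_split /=; congr (_ + _)%N; rewrite mul2n -addnn; congr (_ + _)%N.
rewrite (exchange_big_dep xpredT) //=; apply: eq_bigr => k _.
by apply: eq_bigr => j _; rewrite mulnC.
Qed.

Lemma Dexp_sqr A : (2 * Dexp A + 2 * \sum_i \sum_j A i j ^ 2 =
  \sum_i (\sum_j A i j) ^ 2 + \sum_j (\sum_i A i j) ^ 2)%N.
Proof.
have sqr_rows (g : 'I_n -> 'I_n -> nat) : (\sum_i (\sum_j g i j) ^ 2 =
    \sum_i \sum_j g i j ^ 2 +
    2 * \sum_(i < n) \sum_(j < n) \sum_(k < n | k < j) g i j * g i k)%N.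
  by rewrite big_distrr -big_split; apply: eq_bigr => i _; rewrite sqr_sum.
rewrite sqr_rows (sqr_rows (fun j i => A i j)) [X in (_ = _ + (X + _))%N]exchange_big /=.
rewrite /Dexp; ring.
Qed.

(** With S the sum of the entries of A, half the sum of the squared row and column sums grows by 2S
    + n, which is exactly what the linear parts of a(a+1) and c(c-1) contribute. *)
Lemma Dexp_reach A C :
  (forall i, \sum_j C i j = \sum_j A i j + 1)%N ->
  (forall j, \sum_i C i j = \sum_i A i j + 1)%N ->
  (Dexp C + \sum_i \sum_j C i j * (C i j).-1 =
   Dexp A + \sum_i \sum_j A i j * (A i j).+1)%N.
Proof.
move=> Cr Cc; have := Dexp_sqr C; have := Dexp_sqr A.
have sqr_succ (x y : 'I_n -> nat) : (forall i, x i = y i + 1)%N ->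
    (\sum_i x i ^ 2 = \sum_i y i ^ 2 + 2 * \sum_i y i + n)%N.
  move=> xy; rewrite big_distrr /= -[X in (_ + X)%N]card_ord -sum1_card -!big_split.
  by apply: eq_bigr => i _; rewrite xy /=; nia.
rewrite (sqr_succ _ _ Cr) (sqr_succ _ _ Cc) /=.
have -> : (\sum_j \sum_i A i j = \sum_i \sum_j A i j)%N by apply: exchange_big.
have -> : (\sum_i \sum_j A i j * (A i j).+1 = \sum_i \sum_j A i j ^ 2 + \sum_i \sum_j A i j)%N.
  rewrite -big_split; apply: eq_bigr => i _; rewrite -big_split.
  by apply: eq_bigr => j _; rewrite mulnS addnC mulnn.
have : (\sum_i \sum_j C i j ^ 2 = \sum_i \sum_j C i j * (C i j).-1 + \sum_i \sum_j C i j)%N.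
  rewrite -big_split; apply: eq_bigr => i _; rewrite -big_split.
  by apply: eq_bigr => j _; case: (C i j) => //= c; rewrite -mulnSr mulnn.
have -> : (\sum_i \sum_j C i j = \sum_i \sum_j A i j + n)%N.
  rewrite -[X in (_ + X)%N]card_ord -sum1_card -big_split.
  by apply: eq_bigr => i _; rewrite Cr.
move: (Dexp A) (Dexp C) (\sum_i (\sum_j A i j) ^ 2)%N (\sum_j (\sum_i A i j) ^ 2)%N.
move: (\sum_i \sum_j A i j)%N (\sum_i \sum_j A i j ^ 2)%N.
move: (\sum_i \sum_j C i j ^ 2)%N (\sum_i \sum_j C i j * (C i j).-1)%N.
lia.
Qed.
End Exponents.

(** * Multiplication by det_q on the normalized monomials of O_q *)

Section Lattice.
Context (K : fieldType) (q : K) (q_neq0 : q != 0) (n : nat).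
Implicit Types (A C : 'M[nat]_n).

Lemma Oq_qmatrix : @qmatrix K q n (Oq q n) (Z q (n := n)).
Proof.
have ZE (i j s u : 'I_n) : Z q i j * Z q s u = toOq q (gen K i j * gen K s u).
  exact: toOq_mul.
have cZE c (i j s u : 'I_n) :
    c *: (Z q i j * Z q s u) = toOq q (c *: (gen K i j * gen K s u)).
  by rewrite ZE; exact: toOq_scale.
split=> [i j k jk|i j k ik|i j s u si ju|i j s u si ju].
- exact: etrans (ZE _ _ _ _) (etrans (qrelE (qrel_row q i jk)) (esym (cZE _ _ _ _ _))).
- exact: etrans (ZE _ _ _ _) (etrans (qrelE (qrel_col q j ik)) (esym (cZE _ _ _ _ _))).
- exact: etrans (ZE _ _ _ _) (etrans (qrelE (qrel_anti q si ju)) (esym (ZE _ _ _ _))).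
- exact: etrans (ZE _ _ _ _) (etrans (qrelE (qrel_diag q si ju))
    (etrans (raddfD (toOq q (n := n)) _ _)
      (congr2 +%R (esym (ZE _ _ _ _)) (esym (cZE _ _ _ _ _))))).
Qed.

Lemma det_q_minor : det_q q n = minor q (Z q (n := n)) (enum 'I_n) setT.
Proof. by rewrite minor_det. Qed.

Lemma prod_scale (I : Type) (R : algType K) (s : seq I) (e : I -> nat) (f : I -> R) :
  \prod_(i <- s) (q ^+ e i *: f i) = q ^+ (\sum_(i <- s) e i)%N *: \prod_(i <- s) f i.
Proof.
elim: s => [|i s IH]; first by rewrite !big_nil scale1r.
by rewrite !big_cons IH -scalerAl -scalerAr scalerA exprD.
Qed.

Lemma rtail_Zmon (e : nat -> nat) A :
  rtail (fun i j a => q ^+ e a *: Z q i j ^+ a) 0 A =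
  q ^+ (\sum_i \sum_j e (A i j))%N *: Zmon q A.
Proof.
rewrite /rtail drop0 /Zmon !index_enum_ord.
under eq_bigr => i _ do rewrite prod_scale.
by rewrite prod_scale.
Qed.

(** By [Dexp_reach] every matrix reached carries the same power q^(Dexp A + e) as A, so this power
    cancels. *)
Lemma det_q_Znorm A : exists2 y, span q (fun=> True) (Znorm q (n := n)) y &
  det_q q n * Znorm q A = Znorm q (A + 1%:M) + q *: y.
Proof.
have [y sy Ey] := span_lead_rows q_neq0 Oq_qmatrix (erefl : 0 + n = n)%N A.
have addE : addI 0 A = A + 1%:M.
  by apply/matrixP => i j; rewrite !mxE leq0n andbT; case: (i == j).
have leadE : lead n 0 = setT by apply/setP => j; rewrite !inE.
rewrite drop0 leadE -det_q_minor addE in Ey.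
set e := (\sum_i \sum_j A i j * (A i j).+1)%N.
have lowE : rtail (low q (Z q (n := n))) 0 A = q ^+ (Dexp A + e) *: Znorm q A.
  rewrite /Znorm scalerA exprD mulrAC mulfV ?expf_neq0 // mul1r.
  exact: rtail_Zmon.
have upE C : reach true 0 0 setT A C ->
    rtail (up q (Z q (n := n))) 0 C = q ^+ (Dexp A + e) *: Znorm q C.
  case=> _ Cr Cc; rewrite /Znorm scalerA -(@Dexp_reach _ A C).
  - by rewrite exprD mulrAC mulfV ?expf_neq0 // mul1r; apply: rtail_Zmon.
  - by move=> i; rewrite Cr andbT; case: (nat_of_ord i).
  - by move=> j; rewrite Cc inE.
have upE1 : rtail (up q (Z q (n := n))) 0 (A + 1%:M) = q ^+ (Dexp A + e) *: Znorm q (A + 1%:M).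
  have sum1 (i : 'I_n) (P : 'I_n -> bool) : (forall j, P j = (j == i)) ->
      (\sum_j (P j)%:R = 1 :> nat).
    move=> Pi; rewrite (bigD1 i) //= Pi eqxx big1 ?addr0 // => j ji.
    by rewrite Pi (negPf ji).
  apply: upE; split=> [r j|r|j]; first by rewrite !ltn0 andbF.
    under eq_bigr => j _ do rewrite !mxE.
    by rewrite big_split /= (sum1 r) 1?eq_sym //; case: (nat_of_ord r).
  under eq_bigr => i _ do rewrite !mxE.
  by rewrite big_split /= (sum1 j) // inE.
have [y' sy' yE] := @span_unscale _ _ _ _ _ (fun=> True) _ (Znorm q (n := n)) _ _
  (fun C rC => conj I (upE C rC)) sy.
exists y' => //; have qE : q ^+ (Dexp A + e) != 0 by rewrite expf_neq0.
apply: (scalerI qE).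
by rewrite [LHS]scalerAr -lowE Ey upE1 yE [RHS]scalerDr !scalerA [q * _]mulrC.
Qed.

End Lattice.

Section Lincomb.
Context (K : fieldType) (q : K) (n : nat) (f : 'M[nat]_n -> Oq q n).
Implicit Types c d : {malg {poly int}['M[nat]_n]}.

Lemma lincombEw (s : {fset 'M[nat]_n}) c : (msupp c `<=` s)%fset ->
  lincomb f c = \sum_(A <- s) ofZq q (mcoeff A c) *: f A.
Proof.
move=> cs; rewrite /lincomb (big_fset_incl _ cs) //= => A _ /mcoeff_outdom ->.
by rewrite rmorph0 scale0r.
Qed.

Lemma lincombD c d : lincomb f (c + d) = lincomb f c + lincomb f d.
Proof.
rewrite (lincombEw (msuppD_le c d)) (lincombEw (fsubsetUl (msupp c) (msupp d))).
rewrite (lincombEw (fsubsetUr (msupp c) (msupp d))) -big_split /=.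
by apply: eq_bigr => A _; rewrite mcoeffD rmorphD scalerDl.
Qed.

Lemma lincombZ p c : lincomb f (p *: c) = ofZq q p *: lincomb f c.
Proof.
rewrite (lincombEw (msuppZ_le p c)) scaler_sumr; apply: eq_bigr => A _.
by rewrite mcoeffZ rmorphM scalerA.
Qed.

Lemma lincombU p A : lincomb f << p *g A >> = ofZq q p *: f A.
Proof. by rewrite (lincombEw msuppU_le) big_seq_fset1 mcoeffUU. Qed.

Lemma span_lincomb P x : span q P f x -> exists c, x = lincomb f c.
Proof.
elim=> [|y z _ [c ->] _ [d ->]|p A _].
- by exists 0; rewrite /lincomb msupp0 big_seq_fset0.
- by exists (c + d); rewrite lincombD.
- by exists << p *g A >>; rewrite lincombU.
Qed.

Lemma lincomb_dvdX (P : 'M[nat]_n -> Prop) c :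
  (forall A, A \in msupp c -> P A /\ exists p, mcoeff A c = 'X * p) ->
  exists2 x, span q P f x & lincomb f c = q *: x.
Proof.
rewrite /lincomb big_seq => cX; elim/big_rec: _ => [|A y /cX[PA [p ->]] [x sx ->]].
  by exists 0; [apply: span0 | rewrite scaler0].
exists (ofZq q p *: f A + x); first by apply: spanD => //; apply: span_gen.
by rewrite rmorphM /= ofZqX -scalerA -scalerDr.
Qed.

End Lincomb.

(** * Bar-invariance of det_q, and its commutation with the lattice *)

Section BarDet.
Context (K : fieldType) (q : K) (q_neq0 : q != 0) (n : nat).
Context (phi : {rmorphism K -> K}) (phi_q : phi q = q^-1).
Local Notation bar := (@bar K q n phi).
Local Notation minor := (minor q (Z q (n := n))).

Lemma bar0 : bar 0 = 0.
Proof. by rewrite -[X in bar X](subrr 0) barB // subrr. Qed.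

Lemma bar1 : bar 1 = 1.
Proof.
rewrite -[X in bar X](rmorph1 (toOq q (n := n))) barE // [LHS]bar_freeU.

by rewrite [phi 1]rmorph1 scale1r /bar_word fm1 big_nil.
Qed.

Lemma barD : {morph bar : x y / x + y}.
Proof.
by move=> x y; rewrite -[y in LHS]opprK -[- y]sub0r !barB // bar0 sub0r opprK.
Qed.

(** Bar turns the expansion along the top row into that of [prow_right]. *)
Lemma bar_minor (w : seq 'I_n) J : pairwise (@ltI n) w -> bar (minor w J) = minor w J.
Proof.
elim: w J => [|i w IH] J.
  move=> _ /=; case: eqP => _; last exact: bar0.
  exact: bar1.
rewrite pairwise_cons => /andP[iw pw] /=.
rewrite [RHS](prow_right q_neq0 (commrow_minor q_neq0 (Oq_qmatrix q n) iw)).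
rewrite prow0E (big_morph _ barD bar0); apply: eq_bigr => j _.
rewrite barZ // barM // bar_gen // IH //; congr (_ *: _).
by rewrite rmorphXn rmorphN rmorphXn /= phi_q exprVn -invrN exprVn.
Qed.

Lemma bar_det_q : bar (det_q q n) = det_q q n.
Proof. by rewrite det_q_minor bar_minor // enum_pairwise. Qed.

Lemma det_q_gen_comm i j : det_q q n * Z q i j = Z q i j * det_q q n.
Proof. by rewrite det_q_minor (minor_setT_comm q_neq0 (Oq_qmatrix q n)). Qed.

Lemma det_q_Znorm_comm A : det_q q n * Znorm q A = Znorm q A * det_q q n.
Proof.
rewrite /Znorm -scalerAr -scalerAl; congr (_ *: _).
rewrite /Zmon; apply: commr_prod => i _; apply: commr_prod => j _.
by apply: commrX; apply: det_q_gen_comm.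
Qed.

Lemma det_q_span P x : span q P (Znorm q (n := n)) x ->
  span q (fun=> True) (Znorm q (n := n)) (det_q q n * x) /\
  det_q q n * x = x * det_q q n.
Proof.
elim=> [|y z _ [sy yC] _ [sz zC]|p A _].
- by rewrite mulr0 mul0r; split=> //; apply: span0.
- by rewrite mulrDr mulrDl yC zC -{1}yC -{1}zC; split=> //; apply: spanD.
rewrite -scalerAr -scalerAl det_q_Znorm_comm; split=> //; apply: spanZ.
rewrite -det_q_Znorm_comm; have [y sy ->] := det_q_Znorm q_neq0 A.
apply: spanD; last by have := spanZ 'X sy; rewrite ofZqX.
exact: span_mem.
Qed.

End BarDet.

(* q^N times the bar conjugate of p(q), when p has degree at most N. *)
Definition rev_poly (N : nat) (p : {poly int}) : {poly int} :=
  \poly_(i < N.+1) p`_(N - i).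

Lemma ofZq_rev_poly (K : fieldType) (x : K) N (p : {poly int}) :
  x != 0 -> (size p <= N.+1)%N -> x ^+ N * ofZq x^-1 p = ofZq x (rev_poly N p).
Proof.
move=> x0 sp; rewrite /ofZq !(@horner_coef_wide _ N.+1); last 2 first.
- exact: leq_trans (size_poly _ _) (size_poly _ _).
- exact: leq_trans (size_poly _ _) sp.
rewrite mulr_sumr [RHS](reindex_inj rev_ord_inj) /=; apply: eq_bigr => i _.
have iN : (i <= N)%N by rewrite -ltnS.
rewrite !coef_map /= coef_poly subSS ltnS leq_subr subKn //.
rewrite mulrCA; congr (_ * _).
by rewrite -{1}(subnK iN) exprD exprVn -mulrA mulfV ?mulr1 // expf_neq0.
Qed.

(** * Bar-invariant elements are determined modulo q *)

Section Uniqueness.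
Context (K : fieldType) (q : K) (q_neq0 : q != 0) (n : nat).
Context (phi : {rmorphism K -> K}) (phi_q : phi q = q^-1).
Context (b : 'M[nat]_n -> Oq q n) (b_basis : is_Zq_basis (@Lstar K q n) b).
Hypothesis b_bar : forall A, bar phi (b A) = b A.

Lemma phi_ofZq (p : {poly int}) : phi (ofZq q p) = ofZq q^-1 p.
Proof.
rewrite /ofZq -horner_map -map_poly_comp -phi_q; congr (_.[_]).
by apply: eq_map_poly => z /=; rewrite rmorph_int.
Qed.

Lemma Lstar_span P x : span q P (Znorm q (n := n)) x -> exists c, x = lincomb b c.
Proof.
by move=> /span_lincomb/(proj2 b_basis)[c [xc _]]; exists c.
Qed.

(** Uniqueness of coordinates is given only on L^*, so the combination is first shown to lie
    there. *)
Lemma lincomb_inj c d : lincomb b c = lincomb b d -> c = d.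
Proof.
move=> cd; have Lc : Lstar (lincomb b c).
  apply: (span_lincomb (P := fun=> True)); rewrite /lincomb.
  elim/big_rec: _ => [|A y _ sy]; first exact: span0.
  apply: spanD => //; apply: spanZ.
  have [e ->] := proj1 b_basis A; rewrite /lincomb.
  elim/big_rec: _ => [|C z _ sz]; first exact: span0.
  by apply: spanD => //; apply: span_gen.
have [e [_ uniq_e]] := proj2 b_basis _ Lc.
by rewrite -(uniq_e c) // -(uniq_e d).
Qed.

(* If c were nonzero, multiplying both sides by a large power of q would give two
   different Z[q]-combinations of b. *)
Lemma bar_lincomb_eq0 c :
  bar phi (q *: lincomb b c) = q *: lincomb b c -> lincomb b c = 0.
Proof.
move=> bar_c; have [N sizeN] : exists N, forall A, (size (mcoeff A c) <= N)%N.
  exists (\max_(A <- msupp c) size (mcoeff A c))%N => A.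
  case: (boolP (A \in msupp c)) => [Ac|/mcoeff_outdom ->]; last by rewrite size_poly0.
  exact: leq_bigmax_seq.
have [d sizeD dE] : exists2 d : {malg {poly int}['M[nat]_n]},
    (forall A, size (mcoeff A d) <= N.+1)%N &
    lincomb b d = q ^+ N *: bar phi (lincomb b c).
  exists (\sum_(A <- msupp c) << rev_poly N (mcoeff A c) *g A >>) => [A|].
    rewrite raddf_sum; apply: leq_trans (size_sum _ _ _) _.
    apply/bigmax_leqP_seq => B _ _; rewrite /= mcoeffU.
    by case: eqP => _; [apply: size_poly | rewrite size_poly0].
  have b0 := bar0 q_neq0 n phi_q; have bD := barD q_neq0 (n := n) phi_q.
  have lincomb0 : lincomb b 0 = 0 by rewrite /lincomb msupp0 big_seq_fset0.
  rewrite (big_morph (lincomb b) (lincombD b) lincomb0).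
  rewrite [in RHS]/lincomb (big_morph _ bD b0) scaler_sumr.
  apply: eq_bigr => A _; rewrite lincombU barZ // b_bar scalerA.
  by rewrite phi_ofZq ofZq_rev_poly // (leq_trans (sizeN A)).
(* For x = [lincomb b c] the hypothesis says q^-1 bar x = q x, hence q^N bar x = q^(N+2) x, while
   [d] has degrees at most N. *)
have /lincomb_inj dc : lincomb b d = lincomb b ('X^(N.+2) *: c).
  rewrite dE lincombZ ofZqXn (exprSr q N.+1) -scalerA.
  have -> : q *: lincomb b c = q^-1 *: bar phi (lincomb b c).
    by rewrite -[LHS]bar_c barZ // phi_q.
  by rewrite scalerA exprSr mulfK.
suff -> : c = 0 by rewrite /lincomb msupp0 big_seq_fset0.
apply/malgP => A; rewrite mcoeff0; apply/eqP; apply: contraTT isT => c0.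
have := sizeD A; rewrite dc mcoeffZ (mulrC 'X^_) size_mulXn //.
by rewrite leqNgt ltnS leq_addr.
Qed.

Lemma bar_eq_leading A x y z :
  bar phi x = x -> span q (fun=> True) (Znorm q (n := n)) y ->
  span q (fun=> True) (Znorm q (n := n)) z ->
  x = Znorm q A + q *: y -> b A = Znorm q A + q *: z -> x = b A.
Proof.
move=> xbar sy sz xE bE.
have [c cE] : exists c, y - z = lincomb b c.
  apply: (@Lstar_span (fun=> True)); apply: spanD => //.
  by rewrite -scaleN1r -[- 1](rmorphN1 (ofZq q)); apply: spanZ.
have xbE : x - b A = q *: lincomb b c.
  by rewrite xE bE -cE scalerBr opprD addrACA subrr add0r.
apply/eqP; rewrite -subr_eq0 xbE bar_lincomb_eq0 ?scaler0 //.
by rewrite -xbE barB // xbar b_bar.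
Qed.

Hypothesis b_leading : forall A,
  exists2 z, span q (fun=> True) (Znorm q (n := n)) z & b A = Znorm q A + q *: z.

Lemma Bstar_mul_det_q A : b A * det_q q n = b (A + 1%:M).
Proof.
have [z sz bE] := b_leading A; have [z' sz' bE'] := b_leading (A + 1%:M).
have [y sy Ey] := det_q_Znorm q_neq0 A.
have [sdz dzC] := det_q_span q_neq0 sz.
have bC : det_q q n * b A = b A * det_q q n.
  by rewrite bE mulrDr mulrDl -(scalerAr _ _ z) -(scalerAl _ z) dzC det_q_Znorm_comm.
apply: bar_eq_leading (spanD sy sdz) sz' _ bE'.
  by rewrite barM // bar_det_q // b_bar.
by rewrite -bC bE mulrDr Ey -(scalerAr _ _ z) scalerDr addrA.
Qed.

End Uniqueness.

Theorem proposition3p6 (n : nat) (b : 'M[nat]_n -> Oq q n) (hb : is_Bstar b) :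
  (forall x : Oq q n, (exists A, x = b A) -> exists A, x * det_q q n = b A) /\
  (forall A : 'M[nat]_n, b A * det_q q n = b (A + 1%:M)).
Proof.
suff main A : b A * det_q q n = b (A + 1%:M).
  by split=> // x [A ->]; exists (A + 1%:M).
apply: (Bstar_mul_det_q q_neq0 barKq (Bstar_basis hb) (Bstar_bar hb)) => B.
have [h [bE hX]] := Bstar_triangular hb B.
have [C Ch|z sz hE] := @lincomb_dvdX _ q n (Znorm q (n := n)) (fun=> True) h.
  by have [_ _ _] := hX C Ch.
by exists z; rewrite // bE hE.
Qed.
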